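(* Let $d\ge1$ and $\lambda=(d-1)/2$. Suppose that $Q$ is an isotropic probability kernel on $\mathbb{S}_d$ and that, for $\eta\in\mathbb{S}_d$, $X^\eta=(X_n^\eta)_{n\in\mathbb{N}_0}$ is a Markov chain with start at $\eta$ (i.e. $X_0^\eta=\eta$ with probability $1$) and transition kernel $Q$. (a) The family $\{\mathcal{L}(X^\eta):\eta\in\mathbb{S}_d\}$ of probability measures on the path space $\mathbb{S}_d^{\mathbb{N}_0}$ is isotropic in the sense that $\mathcal{L}(X^\eta)^U=\mathcal{L}(X^{U\eta})$ for all $\eta\in\mathbb{S}_d$, $U\in\mathbb{O}(d+1)$. (b) The latitude process $Y=(Y_n)_{n\in\mathbb{N}_0}$, with $Y_n:=\eta^{t}X_n^\eta$ for all $n\in\mathbb{N}_0$, is a Markov chain with state space $[-1,1]$ and start at $1$. (c) Suppose that $Q(\eta,\cdot)=\sum_{k=0}^\infty w(k)\Delta^\lambda_{k,\eta}$ for all $\eta\in\mathbb{S}_d$. Then the representation $$\mathcal{L}(X_n^\eta)=\sum_{k=0}^\infty w_n(k)\,\Delta^\lambda_{k,\eta}\quad\text{for all }n\in\mathbb{N},\ \eta\in\mathbb{S}_d,$$ holds with $w_1(k):=w(k)$ for all $k\in\mathbb{N}_0$ and, for $n>1$, $$w_n(k):=(\gamma_k^\lambda)^{n-1}w(k)^n,\ k\in\mathbb{N},\qquad w_n(0):=1-\sum_{k=1}^\infty w_n(k).$$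
   Context: $\mathbb{S}_d=\{x\in\mathbb{R}^{d+1}:\|x\|=1\}$ with Borel $\sigma$-field $\mathcal{B}(\mathbb{S}_d)$ and uniform distribution $\mathrm{unif}(\mathbb{S}_d)$; $\mathbb{O}(d+1)$ is the group of orthogonal $(d+1)\times(d+1)$ matrices; $\eta^{t}x$ is the Euclidean inner product; $\mathbb{N}=\{1,2,\dots\}$, $\mathbb{N}_0=\mathbb{N}\cup\{0\}$. A probability kernel $Q$ on $\mathbb{S}_d$ (measurable in the first argument, a probability measure on $\mathcal{B}(\mathbb{S}_d)$ in the second) is isotropic if $Q(\eta,U^{t}A)=Q(U\eta,A)$ for all $\eta\in\mathbb{S}_d$, $A\in\mathcal{B}(\mathbb{S}_d)$, $U\in\mathbb{O}(d+1)$, where $U^{t}A=\{U^{t}x:x\in A\}$. $\mathcal{L}(\cdot)$ denotes the distribution of a random element; $\mathcal{L}(X)$ for a chain $X$ is a probability measure on $\mathbb{S}_d^{\mathbb{N}_0}$ with the $\sigma$-field generated by the coordinate projections, and $\mathcal{L}(X)^U$ is its push-forward under the componentwise application of $x\mapsto Ux$. In (c), $(w(k))_{k\in\mathbb{N}_0}$ is a probability mass function on $\mathbb{N}_0$. $D_k^0=T_k$ is the Chebyshev polynomial of the first kind of degree $k$; for $\lambda>0$, $D_k^\lambda=C_k^\lambda/C_k^\lambda(1)$ with $C_k^\lambda$ the Gegenbauer polynomial of degree $k$, $C_k^\lambda(1)=\frac{\Gamma(2\lambda+k)}{\Gamma(2\lambda)k!}$. $\Delta^\lambda_{0,\eta}=\mathrm{unif}(\mathbb{S}_d)$,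 and for $k\in\mathbb{N}$, $\Delta^\lambda_{k,\eta}$ is the probability distribution on $\mathbb{S}_d$ with $\mathrm{unif}(\mathbb{S}_d)$-density $x\mapsto1+D_k^\lambda(\eta^{t}x)$. The constants are $\gamma_0^0=1$, $\gamma_k^0=1/2$ for $k\in\mathbb{N}$, and $\gamma_k^\lambda=\frac{1}{(1+k/\lambda)\,C_k^\lambda(1)}$ for $\lambda>0$, $k\in\mathbb{N}_0$. *)

(* Defs.v *)
From HB Require Import structures.
From mathcomp Require Import all_boot all_order all_algebra.
From mathcomp Require Import ring lra.
From mathcomp Require Import all_classical all_reals all_analysis.

Set Implicit Arguments.
Unset Strict Implicit.
Unset Printing Implicit Defensive.

Import Order.TTheory GRing.Theory Num.Theory.
Import numFieldNormedType.Exports.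

Local Open Scope classical_set_scope.
Local Open Scope ring_scope.

Section euclidean.
Context {R : realType} {n : nat}.
Implicit Types x y : 'cV[R]_n.

Definition dotv x y : R := \sum_i x i 0 * y i 0.

(* The library norm `|x| on matrices is the sup norm, hence this one. *)
Definition enorm x : R := Num.sqrt (dotv x x).

Lemma dotvE x y : dotv x y = (x^T *m y) 0 0.
Proof. by rewrite mxE; apply: eq_bigr => i _; rewrite mxE. Qed.

Lemma dotv_ge0 x : 0 <= dotv x x.
Proof. by apply: sumr_ge0 => i _; rewrite -expr2 sqr_ge0. Qed.

Lemma dotvC x y : dotv x y = dotv y x.
Proof. by apply: eq_bigr => i _; rewrite mulrC. Qed.

Lemma dotvDl x y z : dotv (x + y) z = dotv x z + dotv y z.
Proof. by rewrite -big_split; apply: eq_bigr => i _; rewrite mxE mulrDl. Qed.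

Lemma dotvNl x z : dotv (- x) z = - dotv x z.
Proof. by rewrite -sumrN; apply: eq_bigr => i _; rewrite mxE mulNr. Qed.

Lemma enorm1P x : reflect (dotv x x = 1) (enorm x == 1).
Proof.
apply: (iffP eqP) => [h|h]; last by rewrite /enorm h sqrtr1.
by rewrite -(sqr_sqrtr (dotv_ge0 x)) -/(enorm x) h expr1n.
Qed.

Lemma dotv_le1 x y : dotv x x = 1 -> dotv y y = 1 -> -1 <= dotv x y <= 1.
Proof.
move=> hx hy; have := dotv_ge0 (x + y); have := dotv_ge0 (x - y).
rewrite !(dotvDl, dotvNl) ![dotv _ (x - y)]dotvC ![dotv _ (x + y)]dotvC.
rewrite !(dotvDl, dotvNl) (dotvC y x) hx hy => h1 h2.
by apply/andP; split; lra.
Qed.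

End euclidean.

Record orthomatrix (R : realType) (n : nat) := Orthomatrix {
  orth_val :> 'M[R]_n ;
  orth_valP : orth_val^T *m orth_val = 1%:M }.

Lemma orth_trP (R : realType) (n : nat) (U : orthomatrix R n) :
  ((orth_val U)^T)^T *m (orth_val U)^T = 1%:M.
Proof. by rewrite trmxK; apply/mulmx1C/orth_valP. Qed.

Definition orth_tr (R : realType) (n : nat) (U : orthomatrix R n) :
  orthomatrix R n := Orthomatrix (orth_trP U).

Lemma dotv_orth (R : realType) (n : nat) (U : orthomatrix R n)
    (x y : 'cV[R]_n) :
  dotv (U *m x) (U *m y) = dotv x y.
Proof.
by rewrite !dotvE trmx_mul mulmxA -(mulmxA _ _ (orth_val U)) orth_valP mulmx1.
Qed.

(* The sphere S_d inside R^(d+1), with the subspace topology and its Borel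
   sigma-field. *)
Record sphere (R : realType) (d : nat) := Sphere {
  sphere_val :> 'cV[R]_d.+1 ;
  sphere_valP : enorm sphere_val == 1 }.

Section sphere_structures.
Context (R : realType) (d : nat).

HB.instance Definition _ := [isSub for @sphere_val R d].
HB.instance Definition _ := [Choice of sphere R d by <:].

Lemma enorm_delta : enorm (delta_mx 0 0 : 'cV[R]_d.+1) == 1.
Proof.
apply/enorm1P; rewrite /dotv (bigD1 0)//= big1 ?addr0; last first.
  by move=> i i0; rewrite !mxE (negbTE i0) mul0r.
by rewrite !mxE !eqxx mulr1.
Qed.

HB.instance Definition _ := isPointed.Build (sphere R d) (Sphere enorm_delta).
HB.instance Definition _ := Topological.copy (sphere R d)
  (initial_topology (@sphere_val R d)).
HB.instance Definition _ := Measurable.copy (sphere R d)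
  (g_sigma_algebraType (@open (sphere R d))).

Lemma sphere_actP (U : orthomatrix R d.+1) (x : sphere R d) :
  enorm (U *m (x : 'cV_d.+1)) == 1.
Proof. by apply/enorm1P; rewrite dotv_orth; apply/enorm1P/sphere_valP. Qed.

Definition sphere_act (U : orthomatrix R d.+1) (x : sphere R d) : sphere R d :=
  Sphere (sphere_actP U x).

End sphere_structures.

(* The state space [-1, 1] of the latitude process, as a Borel space. *)
Record latitude (R : realType) := Latitude {
  latitude_val :> R ;
  latitude_valP : -1 <= latitude_val <= 1 }.

Section latitude_structures.
Context (R : realType).

HB.instance Definition _ := [isSub for @latitude_val R].
HB.instance Definition _ := [Choice of latitude R by <:].

Lemma latitude1P : -1 <= (1 : R) <= 1.
Proof. by apply/andP; split; lra. Qed.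

Definition latitude1 : latitude R := Latitude latitude1P.

HB.instance Definition _ := isPointed.Build (latitude R) latitude1.
HB.instance Definition _ := Topological.copy (latitude R)
  (initial_topology (@latitude_val R)).
HB.instance Definition _ := Measurable.copy (latitude R)
  (g_sigma_algebraType (@open (latitude R))).

Lemma sphere_dotvP (d : nat) (x y : sphere R d) : -1 <= dotv x y <= 1.
Proof. by apply: dotv_le1; apply/enorm1P/sphere_valP. Qed.

Definition latitude_of (d : nat) (eta x : sphere R d) : latitude R :=
  Latitude (sphere_dotvP eta x).

End latitude_structures.

Definition path_space (T : Type) : Type := nat -> T.

Definition path_cylinder (d : measure_display) (T : measurableType d) :
  set (set (path_space T)) :=
  [set E | exists n (A : set T), measurable A /\ E = [set p | A (p n)]].

Section path_space_structures.
Context (d : measure_display) (T : measurableType d).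

HB.instance Definition _ := Pointed.copy (path_space T) (nat -> T).
HB.instance Definition _ := Measurable.copy (path_space T)
  (g_sigma_algebraType (@path_cylinder d T)).

End path_space_structures.

Section markov.
Context (R : realType) (d d' : measure_display).
Context (Omega : measurableType d) (T : measurableType d').
Implicit Type X : nat -> Omega -> T.

(* sigma(X_0, ..., X_n) *)
Definition history X (n : nat) : set (set Omega) :=
  <<s [set E | exists i (A : set T),
         [/\ (i <= n)%N, measurable A & E = X i @^-1` A]] >>.

(* The last clause is P(X_(n+1) \in A | X_0, ..., X_n) = Q(X_n, A) a.s.,
   conditional probability being unfolded. *)
Definition markov_chain (P : probability Omega R) (Q : R.-pker T ~> T)
    (x0 : T) X : Prop :=
  [/\ forall n, measurable_fun setT (X n),
      P (X 0%N @^-1` [set x0]) = 1%E &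
      forall (n : nat) (A : set T) (E : set Omega),
        measurable A -> history X n E ->
        P (E `&` X n.+1 @^-1` A) = (\int[P]_(omega in E) Q (X n omega) A)%E].

Definition path_of X (omega : Omega) : path_space T := fun n => X n omega.

Definition path_law (P : probability Omega R) X :
  set (path_space T) -> \bar R := pushforward P (path_of X).

End markov.

Section isotropy.
Context (R : realType) (d : nat).

Definition isotropic_kernel (Q : R.-pker (sphere R d) ~> (sphere R d)) : Prop :=
  forall (eta : sphere R d) (A : set (sphere R d)) (U : orthomatrix R d.+1),
    measurable A -> Q eta (sphere_act (orth_tr U) @` A) = Q (sphere_act U eta) A.

(* x |-> U x, applied componentwise. *)
Definition path_act (U : orthomatrix R d.+1) (p : path_space (sphere R d)) :
  path_space (sphere R d) := fun n => sphere_act U (p n).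

(* unif(S_d) is the (unique) Borel probability measure on S_d that is
   invariant under O(d+1). *)
Definition is_uniform (unif : probability (sphere R d) R) : Prop :=
  forall (U : orthomatrix R d.+1) (A : set (sphere R d)),
    measurable A -> pushforward unif (sphere_act U) A = unif A.

End isotropy.

Section polynomials.
Context (R : realType).

(* Three-term recurrences:
     T_(k+2) = 2 x T_(k+1) - T_k ,
     (k+2) C_(k+2) = 2 (k+1+l) x C_(k+1) - (k+2l) C_k . *)
Fixpoint chebyshev_pair (k : nat) : {poly R} * {poly R} :=
  if k is k'.+1 then
    let: (p, q) := chebyshev_pair k' in (q, 2 *: ('X * q) - p)
  else (1, 'X).

Definition chebyshev (k : nat) : {poly R} := (chebyshev_pair k).1.

Fixpoint gegenbauer_pair (l : R) (k : nat) : {poly R} * {poly R} :=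
  if k is k'.+1 then
    let: (p, q) := gegenbauer_pair l k' in
    (q, k'.+2%:R^-1 *: ((2 * (k'.+1%:R + l)) *: ('X * q)
                        - (k'%:R + 2 * l) *: p))
  else (1, (2 * l) *: 'X).

Definition gegenbauer (l : R) (k : nat) : {poly R} := (gegenbauer_pair l k).1.

Lemma chebyshevSS k :
  chebyshev k.+2 = 2 *: ('X * chebyshev k.+1) - chebyshev k.
Proof. by rewrite /chebyshev /=; case: chebyshev_pair. Qed.

Lemma gegenbauerSS l k :
  gegenbauer l k.+2 =
  k.+2%:R^-1 *: ((2 * (k.+1%:R + l)) *: ('X * gegenbauer l k.+1)
                 - (k%:R + 2 * l) *: gegenbauer l k).
Proof. by rewrite /gegenbauer /=; case: gegenbauer_pair. Qed.

(* C_k^l(1) = Gamma(2l+k) / (Gamma(2l) k!) *)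
Lemma gegenbauer_at1 l k :
  (gegenbauer l k).[1] = \prod_(i < k) ((2 * l + i%:R) / i.+1%:R).
Proof.
suff: (gegenbauer l k).[1] = \prod_(i < k) ((2 * l + i%:R) / i.+1%:R) /\
  (gegenbauer l k.+1).[1] = \prod_(i < k.+1) ((2 * l + i%:R) / i.+1%:R).
  by case.
elim: k => [|k [IH1 IH2]].
  by rewrite big_ord0 big_ord1 /gegenbauer /= !hornerE /=; split=> //; field.
split=> //; rewrite gegenbauerSS !hornerE IH2 IH1 !big_ord_recr /=.
have k1 : (k.+1%:R : R) != 0 by rewrite pnatr_eq0.
have k2 : (k.+2%:R : R) != 0 by rewrite pnatr_eq0.
move: k1 k2; rewrite -!natr1 => k1 k2; field; exact/andP.
Qed.

(* D_k^l, with value 1 at t = 1. *)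
Definition zonal (l : R) (k : nat) (t : R) : R :=
  if l == 0 then (chebyshev k).[t]
  else (gegenbauer l k).[t] / (gegenbauer l k).[1].

(* gamma_k^l *)
Definition zonal_const (l : R) (k : nat) : R :=
  if l == 0 then (if k == 0%N then 1 else 1 / 2)
  else 1 / ((1 + k%:R / l) * (gegenbauer l k).[1]).

Definition Delta (d : nat) (unif : probability (sphere R d) R) (l : R)
    (k : nat) (eta : sphere R d) (A : set (sphere R d)) : \bar R :=
  if k == 0%N then unif A
  else (\int[unif]_(x in A) (1 + zonal l k (dotv eta x))%:E)%E.

(* The weights w_n; the value at n = 0 is irrelevant. *)
Definition step_weight (l : R) (w : nat -> R) (n k : nat) : R :=
  if n == 1%N then w k
  else if k == 0%N then
    1 - limn (fun N => \sum_(1 <= j < N) zonal_const l j ^+ n.-1 * w j ^+ n)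
  else zonal_const l k ^+ n.-1 * w k ^+ n.

End polynomials.

(* Main.v *)
Require Import Defs.
From HB Require Import structures.
From mathcomp Require Import all_boot all_order all_algebra.
From mathcomp Require Import ring lra.
From mathcomp Require Import all_classical all_reals all_analysis.
From mathcomp Require Import measurable_realfun.

Set Implicit Arguments.
Unset Strict Implicit.
Unset Printing Implicit Defensive.

Import Order.TTheory GRing.Theory Num.Theory.
Import numFieldNormedType.Exports.

Local Open Scope classical_set_scope.
Local Open Scope ring_scope.

(* (a), (b): the image of the chain under a map [f] such that [Q x (f @^-1` A)]
   depends on [x] only through [f x] is again a Markov chain.  For [f] an
   orthogonal map this gives (a), since the law of a chain is determined by its
   kernel and its start; for [f] the latitude it gives (b), since a reflection
   fixing [eta] exchanges any two points of equal latitude.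

   (c): invariance of unif under rotations, differentiated at the identity, is a
   divergence theorem on the sphere.  It turns the bilinear form
   [E (p (eta^t x) * q (zeta^t x))] into one for which the Gegenbauer
   differential operator is symmetric, so distinct [D_k], [D_j] are orthogonal,
   and a three-term recurrence in [eta^t zeta] gives
   [E (D_k (eta^t x) * D_k (zeta^t x)) = gamma_k * D_k (eta^t zeta)].  Hence
   [x |-> Delta_(k,x)(A)] is, up to a constant, an eigenfunction of the
   transition operator, with eigenvalue [gamma_k * w k]. *)

(** * Zonal polynomials *)

(** The polynomials enter only through a recurrence normalised by the value at 1. It is regular at
    [l = 0], where the Gegenbauer polynomials of positive degree vanish, so the circle [d = 1] goes
    through the same argument as higher dimensions. Besides the eigenvalue, the product formula
    yields two facts that make the series tractable: paired with [D_0 = 1] it gives mean zero, and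
    applied to the mean of [(D_k (x^t y) + s * D_k (z^t y))^2] with [s = 1] or [s = -1] it gives
    [|D_k| <= 1]. Hence every [Delta_k] is nonnegative and at most 1, and sums and integrals may be
    exchanged. The form of [w_n] comes from [Delta_(k,x)(A) = unif A + z_k x]: a transition
    multiplies the signed part [z_k] by [gamma_k * w k] and fixes [unif A]. The [n]-th step is [Q]
    itself, with coefficient [w k]; the [n - 1] earlier ones each contribute the eigenvalue, so
    [gamma_k] has one power fewer than [w k]. The mass lost from the positive indices reappears as a
    multiple of unif, which is [w_n(0)]. *)

Section zonal_polynomials.
Context (R : realType) (l : R) (l0 : 0 <= l).

(** The Gegenbauer recurrence divided by the values [C_k(1)]. At [l = 0] the common factor [k.+1]
    cancels and the Chebyshev recurrence remains. *)
Fixpoint zonal_poly_pair (k : nat) : {poly R} * {poly R} :=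
  if k is k'.+1 then
    let: (p, q) := zonal_poly_pair k' in
    (q, (k'.+1%:R + 2 * l)^-1 *:
        ((2 * (k'.+1%:R + l)) *: ('X * q) - k'.+1%:R *: p))
  else (1, 'X).

Definition zonal_poly (k : nat) : {poly R} := (zonal_poly_pair k).1.

Local Notation D := zonal_poly.

Lemma zonal_polySS k : D k.+2 = (k.+1%:R + 2 * l)^-1 *:
  ((2 * (k.+1%:R + l)) *: ('X * D k.+1) - k.+1%:R *: D k).
Proof. by rewrite /zonal_poly /=; case: zonal_poly_pair. Qed.

Lemma zonal_poly_rec k : (k.+1%:R + 2 * l%:P) * D k.+2 =
  2 * (k.+1%:R + l%:P) * 'X * D k.+1 - k.+1%:R * D k.
Proof.
have k0 : k.+1%:R + 2 * l != 0.
  by rewrite gt_eqF// ltr_pwDl// ?ltr0n// mulr_ge0.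
have -> : k.+1%:R + 2 * l%:P = (k.+1%:R + 2 * l)%:P :> {poly R}.
  by rewrite polyCD polyCM !polyC_natr.
rewrite zonal_polySS mul_polyC scalerA divff// scale1r -!mul_polyC.
rewrite !(polyCD, polyCM, polyC_natr); ring.
Qed.

Let shift_neq0 (k : nat) : (k.+1%:R + 2 * l%:P : {poly R}) != 0.
Proof.
rewrite -(polyC_natr _ k.+1) -(polyC_natr _ 2) -polyCM -polyCD polyC_eq0 gt_eqF//.
by rewrite ltr_pwDl// ?ltr0n// mulr_ge0.
Qed.

Lemma zonal_poly_deriv_rec k : (k.+1%:R + 2 * l%:P) * (D k.+2)^`() =
  2 * (k.+1%:R + l%:P) * (D k.+1 + 'X * (D k.+1)^`()) - k.+1%:R * (D k)^`().
Proof.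
have := congr1 deriv (zonal_poly_rec k).
have -> : k.+1%:R + 2 * l%:P = (k.+1%:R + 2 * l)%:P :> {poly R}.
  by rewrite polyCD polyCM !polyC_natr.
have -> : 2 * (k.+1%:R + l%:P) = (2 * (k.+1%:R + l))%:P :> {poly R}.
  by rewrite polyCM polyC_natr polyCD polyC_natr.
rewrite -(polyC_natr R k.+1) -mulrA derivB !derivM !derivC derivX.
by rewrite !mul0r !add0r mul1r.
Qed.

(** Lowering and raising relations, proved together: the recurrence turns the first at [k] into the
    second at [k.+1], while the first at [k.+1] comes from differentiating the recurrence and uses
    both at [k]. *)
Lemma zonal_poly_deriv k :
  (1 - 'X ^+ 2) * (D k.+1)^`() = k.+1%:R * (D k - 'X * D k.+1) /\
  (1 - 'X ^+ 2) * (D k)^`() = (k%:R + 2 * l%:P) * ('X * D k - D k.+1).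
Proof.
elim: k => [|k [IH1 IH0]].
  rewrite /zonal_poly /= derivX -(polyC1 R) derivC !polyC1; split; ring.
split; last first.
  rewrite IH1 (mulrBr (_ + 2 * _)) zonal_poly_rec; ring.
apply: (mulfI (shift_neq0 k)).
rewrite mulrCA zonal_poly_deriv_rec.
transitivity (2 * (k.+1%:R + l%:P) * ((1 - 'X^2) * D k.+1
   + 'X * ((1 - 'X^2) * (D k.+1)^`())) - k.+1%:R * ((1 - 'X^2) * (D k)^`())).
  by ring.
rewrite IH1 IH0.
transitivity (k.+2%:R * ((k.+1%:R + 2 * l%:P) * D k.+1
   - 'X * ((k.+1%:R + 2 * l%:P) * D k.+2))); last by ring.
rewrite zonal_poly_rec; ring.
Qed.

(** Both sides keep the factor [k + 2 * l] because it vanishes for [k = 0], [l = 0]. *)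
Lemma zonal_poly_deriv_succ k :
  (k%:R + 2 * l%:P) * ((D k.+1)^`() - k.+1%:R * D k) = k.+1%:R * ('X * (D k)^`()) /\
  (k%:R + 2 * l%:P) * ('X * (D k.+1)^`() - k.+1%:R * D k.+1) = k.+1%:R * (D k)^`().
Proof.
elim: k => [|k [_ IH]].
  rewrite /zonal_poly /= derivX -(polyC1 R) derivC !polyC1; split; ring.
have h : (k.+1%:R + 2 * l%:P) * ((D k.+2)^`() - k.+2%:R * D k.+1) =
         k.+2%:R * ('X * (D k.+1)^`()).
  rewrite mulrBr zonal_poly_deriv_rec -IH; ring.
split=> //.
have [_ h2] := zonal_poly_deriv k.+1.
transitivity ('X * ((k.+1%:R + 2 * l%:P) * ((D k.+2)^`() - k.+2%:R * D k.+1))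
  + k.+2%:R * ((k.+1%:R + 2 * l%:P) * ('X * D k.+1 - D k.+2))); first by ring.
rewrite h -h2; ring.
Qed.

(** Gegenbauer's equation: differentiate the lowering relation and eliminate the derivative of the
    lower polynomial by [zonal_poly_deriv_succ]. *)
Lemma zonal_poly_ode k :
  (1 - 'X ^+ 2) * (D k)^`()^`() - (1 + 2 * l%:P) * ('X * (D k)^`())
  = - ((k%:R * (k%:R + 2 * l)) *: D k).
Proof.
case: k => [|k].
  by rewrite /zonal_poly /= -(polyC1 R) derivC deriv0 polyC1 !mul0r scale0r; ring.
rewrite -mul_polyC polyCM polyCD polyCM !polyC_natr.
have /(congr1 deriv) := (zonal_poly_deriv k).1.
have [_ h] := zonal_poly_deriv_succ k.
have d1 : (1 - 'X ^+ 2 : {poly R})^`() = - (2 * 'X).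
  by rewrite derivB derivXn -(polyC1 R) derivC polyC1 mulr_natl/= expr1 sub0r.
rewrite derivM d1 -(polyC_natr R k.+1) derivM derivC derivB derivM derivX.
rewrite polyC_natr mul0r add0r mul1r mulrBr -h => e.
transitivity (- (2 * 'X) * (D k.+1)^`() + (1 - 'X^2) * (D k.+1)^`()^`()
  - (2 * l%:P - 1) * ('X * (D k.+1)^`())); first by ring.
rewrite e; ring.
Qed.

(* A primitive of [D k.+1]; at [l = 0, k = 0] the last quotient is the junk
   value 0, but there it multiplies [1^`() = 0]. *)
Definition zonal_primitive k : {poly R} :=
  (((k.+1%:R + 2 * l) / k.+2%:R) *: D k.+2
   - (k.+1%:R / (k%:R + 2 * l)) *: D k).

(** The classical [(C_(k+2) - C_k)' = 2 (k+1+l) C_(k+1)], divided by [C_(k+1)(1)]. *)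
Lemma zonal_primitiveE k :
  (zonal_primitive k)^`() = (2 * (k.+1%:R + l)) *: D k.+1.
Proof.
rewrite /zonal_primitive derivB !derivZ.
have [h _] := zonal_poly_deriv_succ k.+1.
have [_ h2] := zonal_poly_deriv_succ k.
have k2 : (k.+2%:R : R) != 0 by rewrite pnatr_eq0.
have {h} -> : ((k.+1%:R + 2 * l) / k.+2%:R) *: (D k.+2)^`() =
     'X * (D k.+1)^`() + (k.+1%:R + 2 * l) *: D k.+1.
  apply: (@mulfI _ (k.+2%:R)%:P); first by rewrite polyC_eq0.
  rewrite [RHS]mulrDr polyC_natr -h -polyC_natr !mul_polyC !scalerA.
  rewrite mulrCA divff// mulr1 -!mul_polyC !(polyCD, polyCM, polyC_natr).
  ring.
have [kl|kl] := eqVneq (k%:R + 2 * l) 0.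
  have [-> l_0] : k = 0%N /\ l = 0.
    have : k%:R + 2 * l == 0 by rewrite kl.
    by rewrite paddr_eq0 ?ler0n ?mulr_ge0// pnatr_eq0 mulf_eq0 pnatr_eq0/=
      => /andP[/eqP -> /eqP ->].
  rewrite l_0 /zonal_poly/= derivX -(polyC1 R) derivC polyC1 scaler0 subr0.
  by rewrite -mul_polyC -[RHS]mul_polyC !(polyCM, polyCD, polyC0, polyC1); ring.
have -> : (k.+1%:R / (k%:R + 2 * l)) *: (D k)^`() =
    'X * (D k.+1)^`() - k.+1%:R * D k.+1.
  apply: (@mulfI _ (k%:R + 2 * l)%:P); first by rewrite polyC_eq0.
  rewrite mul_polyC scalerA mulrCA divff// mulr1 polyCD polyCM !polyC_natr h2.
  by rewrite -mul_polyC polyC_natr.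
rewrite -!mul_polyC !(polyCM, polyCD, polyC_natr); ring.
Qed.

Lemma zonal_const0 : zonal_const l 0 = 1.
Proof.
rewrite /zonal_const; case: ifP => // /negbT l1.
by rewrite gegenbauer_at1 big_ord0 mul0r addr0 mulr1 divr1.
Qed.

(** The recurrence of [zonal_constS] one index lower would carry a factor [l] on both sides and say
    nothing at [l = 0]; here that factor is cancelled. *)
Lemma zonal_const1 : 2 * (l + 1) * zonal_const l 1 = 1.
Proof.
rewrite /zonal_const; case: ifP => [/eqP ->|/negbT l1]; first by lra.
rewrite gegenbauer_at1 big_ord1/=.
have l2 : l + 1 != 0 by rewrite gt_eqF// ltr_wpDl.
by field; rewrite l1.
Qed.

Lemma zonal_constS k : (2 * l + k.+1%:R) * (l + k.+2%:R) * zonal_const l k.+2 =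
  k.+2%:R * (l + k.+1%:R) * zonal_const l k.+1.
Proof.
rewrite /zonal_const; case: ifP => [/eqP ->/=|/negbT l1]; first by ring.
rewrite !gegenbauer_at1 big_ord_recr/=.
have n0 n : (l + n.+1%:R) != 0 by rewrite gt_eqF// ltr_wpDl ?ltr0n.
have p0 : (\prod_(i < k.+1) ((2 * l + i%:R) / i.+1%:R)) != 0.
  apply/prodf_neq0 => i _; rewrite mulf_neq0 ?invr_neq0 ?pnatr_eq0//.
  rewrite gt_eqF// ltr_pwDl// mulr_gt0 ?ltr0n// lt_neqAle l0 eq_sym l1//.
move: p0; set p := \prod_(_ < _) _ => p0.
have k2 : k.+2%:R != 0 :> R by rewrite pnatr_eq0.
have k3 : (2 * l + k.+1%:R) != 0.
  by rewrite gt_eqF// ltr_wpDl ?mulr_ge0 ?ltr0n.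
have n1 := n0 k.+1; have n2 := n0 k.
move: k2 k3 n1 n2; rewrite -(natr1 k.+1) -(natr1 k) => k2 k3 n1 n2.
by field; rewrite l1 p0 k2 k3 n1 n2.
Qed.

Lemma zonal_const_gt0 k : 0 < zonal_const l k.
Proof.
rewrite /zonal_const; case: ifP => [/eqP _|/negbT l1]; first by case: ifP; lra.
have lp : 0 < l by rewrite lt_neqAle l0 eq_sym l1.
rewrite divr_gt0// mulr_gt0//; first by rewrite ltr_pwDl// divr_ge0.
rewrite gegenbauer_at1 prodr_gt0// => i _.
by rewrite divr_gt0 ?ltr0n// ltr_pwDl ?mulr_gt0.
Qed.

(** From index 1 on the constants decrease, since [(k+2)(l+k+1) <= (2l+k+1)(l+k+2)]. *)
Lemma zonal_const_le1 k : zonal_const l k <= 1.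
Proof.
case: k => [|k]; first by rewrite zonal_const0.
elim: k => [|k IH].
  have l2 : 0 < 2 * (l + 1) by rewrite mulr_gt0 ?ltr0n// ltr_wpDl.
  by rewrite -(ler_pM2l l2) zonal_const1; have := l0; lra.
apply: le_trans IH.
rewrite -(ler_pM2l (_ : 0 < (2 * l + k.+1%:R) * (l + k.+2%:R))).
  rewrite zonal_constS ler_pM2r ?zonal_const_gt0// -!natr1.
  by have := ler0n R k; have := l0; nra.
by rewrite mulr_gt0// ltr_wpDl ?mulr_ge0 ?ltr0n.
Qed.

Lemma zonalE k t : zonal l k t = (D k).[t].
Proof.
rewrite /zonal; case: ifP => [/eqP l1|/negbT l1].
  suff: Defs.chebyshev R k = D k /\ Defs.chebyshev R k.+1 = D k.+1 by case=> ->.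
  elim: k => [|k [IH1 IH2]]; first by [].
  split=> //; rewrite chebyshevSS zonal_polySS IH1 IH2 l1 mulr0 !addr0.
  rewrite scalerBr !scalerA mulVf ?pnatr_eq0// scale1r mulrCA mulVf ?pnatr_eq0//.
  by rewrite mulr1.
have lp : 0 < l by rewrite lt_neqAle l0 eq_sym l1.
have g0 n : (gegenbauer l n).[1] != 0.
  rewrite gegenbauer_at1 gt_eqF// prodr_gt0// => i _.
  by rewrite divr_gt0 ?ltr0n// ltr_pwDl ?mulr_gt0.
suff: (gegenbauer l k).[t] = (gegenbauer l k).[1] * (D k).[t] /\
  (gegenbauer l k.+1).[t] = (gegenbauer l k.+1).[1] * (D k.+1).[t].
  by case=> -> _; rewrite mulrAC divff// mul1r.
elim: k => [|k [IH1 IH2]].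
  rewrite !gegenbauer_at1 big_ord0 big_ord1/=.
  by rewrite /gegenbauer /zonal_poly/= !hornerE; split; field.
split=> //; rewrite gegenbauerSS zonal_polySS !hornerE IH1 IH2 !gegenbauer_at1.
rewrite !big_ord_recr/=; set p := \prod_(_ < _) _.
have k2 : k.+2%:R != 0 :> R by rewrite pnatr_eq0.
have k1 : k.+1%:R != 0 :> R by rewrite pnatr_eq0.
have k3 : (k.+1%:R + 2 * l) != 0.
  by rewrite gt_eqF// ltr_pwDl ?mulr_ge0 ?ltr0n.
move: k1 k2 k3; rewrite -(natr1 k.+1) -(natr1 k) => k1 k2 k3; field.
by rewrite k1 k2 k3.
Qed.

Lemma zonal_poly_at1 k : (D k).[1] = 1.
Proof.
suff: (D k).[1] = 1 /\ (D k.+1).[1] = 1 by case.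
elim: k => [|k [IH0 IH1]]; first by rewrite /zonal_poly/= !hornerE.
split=> //; rewrite zonal_polySS !hornerE IH0 IH1 /=.
have : k.+1%:R + 2 * l != 0 by rewrite gt_eqF// ltr_pwDl// ?ltr0n// mulr_ge0.
by rewrite -(natr1 k) => k0; field.
Qed.

End zonal_polynomials.

(** * Bilinear forms satisfying a divergence identity *)

Section stein_form.
Context (R : realType) (l c : R) (l0 : 0 <= l).
Context (B : {poly R} -> {poly R} -> R).
Hypothesis BDl : forall p q r, B (p + q) r = B p r + B q r.
Hypothesis BDr : forall p q r, B p (q + r) = B p q + B p r.
Hypothesis BZl : forall a p q, B (a *: p) q = a * B p q.
Hypothesis BZr : forall a p q, B p (a *: q) = a * B p q.
Hypothesis B11 : B 1 1 = 1.
(** The model is [B p q = E (p (eta^t x) * q (zeta^t x))] with [c = eta^t zeta]; the two identities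
    are the divergence theorem for the tangential fields of [eta] and of [zeta]. *)
Hypothesis stein_l : forall p q, B ((1 - 'X ^+ 2) * p^`()) q +
  (c * B p q^`() - B ('X * p) ('X * q^`())) = (1 + 2 * l) * B ('X * p) q.
Hypothesis stein_r : forall p q, B p ((1 - 'X ^+ 2) * q^`()) +
  (c * B p^`() q - B ('X * p^`()) ('X * q)) = (1 + 2 * l) * B p ('X * q).

Local Notation D := (zonal_poly l).

Let BBl p q r : B (p - q) r = B p r - B q r.
Proof. by rewrite -scaleN1r BDl BZl mulN1r. Qed.

Let BBr p q r : B p (q - r) = B p q - B p r.
Proof. by rewrite -scaleN1r BDr BZr mulN1r. Qed.

(** For [L p = (1 - 'X^2) p'' - (1 + 2 l) 'X p'], the two identities applied to derivatives give
    [B (L p) q] and [B p (L q)] the same value [B ('X p') ('X q') - c * B p' q']. So [L] is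
    symmetric, and its eigenvalues [- k (k + 2 l)] are distinct. *)
Lemma stein_orthogonal j k : j != k -> B (D j) (D k) = 0.
Proof.
move=> jk.
have ode n : (1 - 'X ^+ 2) * (D n)^`()^`() =
    (1 + 2 * l) *: ('X * (D n)^`()) - (n%:R * (n%:R + 2 * l)) *: D n.
  have := zonal_poly_ode l0 n.
  rewrite -!(mul_polyC (1 + _)) polyCD polyCM polyC_natr polyC1.
  by rewrite -mul_polyC => <-; ring.
have := stein_r (D j) (D k)^`(); have := stein_l (D j)^`() (D k).
rewrite !ode BBl BBr !BZl !BZr.
move=> h1 h2.
have /eqP : (j%:R * (j%:R + 2 * l) - k%:R * (k%:R + 2 * l)) * B (D j) (D k) = 0.
  by lra.
have -> : j%:R * (j%:R + 2 * l) - k%:R * (k%:R + 2 * l) =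
    (j%:R - k%:R) * (j%:R + k%:R + 2 * l) by ring.
rewrite !mulf_eq0 subr_eq0 eqr_nat (negbTE jk)/= gt_eqF; first by move/eqP.
rewrite ltr_pwDl// ?mulr_ge0// -natrD ltr0n addn_gt0.
by case: j k jk {h1 h2} => [|j] [|k].
Qed.

(** Induction over two consecutive indices. In [stein_r] for a primitive of [D k.+1] and for
    [D k.+1] itself, everything expands in [D k] and [D k.+2] apart from [c * B (D k.+1) (D k.+1)].
    Orthogonality leaves [B (D k.+2) (D k.+2)] as the only unknown, and the term in [c] feeds the
    three-term recurrence at [c]. *)
Lemma stein_product j k :
  B (D j) (D k) = if j == k then zonal_const l k * (D k).[c] else 0.
Proof.
case: eqVneq => [->|]; last exact: stein_orthogonal.
suff: B (D k) (D k) = zonal_const l k * (D k).[c] /\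
  B (D k.+1) (D k.+1) = zonal_const l k.+1 * (D k.+1).[c] by case.
elim: k => [|k [IH0 IH1]].
  rewrite zonal_const0 /zonal_poly/= B11 !hornerE; split=> //.
  (* This instance amounts to [c = 2 * (l + 1) * B 'X 'X]. *)
  have := stein_r 'X 1; rewrite -(polyC1 R) derivC derivX !polyC1 !mulr0.
  rewrite mulr1 B11.
  have -> : B 'X 0 = 0 by rewrite -(scale0r 0) BZr mul0r.
  have := zonal_const1 l0; have := l0 => l_ge0 z1 h.
  have l2 : 2 * (l + 1) != 0 by rewrite gt_eqF//; lra.
  by apply: (mulfI l2); rewrite mulrA z1; lra.
split=> //.
set g := B (D k.+2) (D k.+2).
have k1 : 2 * (k.+1%:R + l) != 0.
  by rewrite gt_eqF// mulr_gt0 ?ltr0n// ltr_pwDl ?ltr0n.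
set m := 2 * (k.+1%:R + l) in k1 *.
have X1 : 'X * D k.+1 = ((k.+1%:R + 2 * l) / m) *: D k.+2 + (k.+1%:R / m) *: D k.
  apply: (@mulfI _ m%:P); first by rewrite polyC_eq0.
  rewrite mulrDr !mul_polyC !scalerA ![m * (_ / m)]mulrC !mulfVK//.
  rewrite -!mul_polyC /m !polyCM !polyCD polyCM !polyC_natr.
  rewrite zonal_poly_rec//; ring.
(* [e] comes from the [D k] part of the primitive. For [k = l = 0] its denominator is 0, but the
   quotient is multiplied by [k = 0], so [zk] holds there too. *)
set e := k.+1%:R / (k%:R + 2 * l) * k%:R.
have zk : (k.+1%:R + e) * zonal_const l k = m * zonal_const l k.+1.
  rewrite /e /m; case: (k) => [|n]; last first.
    have n2 : n.+1%:R + 2 * l != 0.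
      by rewrite gt_eqF// ltr_pwDl ?mulr_ge0 ?ltr0n.
    have n3 : l + n.+2%:R != 0 by rewrite gt_eqF// ltr_wpDl ?ltr0n.
    have := zonal_constS l0 n.
    move: n2 n3; rewrite -(natr1 n.+1) -(natr1 n) => n2 n3 zn.
    apply: (mulfI n2); rewrite mulrCA [_ * (_ * zonal_const _ n.+2)]mulrCA.
    rewrite (_ : _ * zonal_const l n.+2 = (n%:R + 1 + 1) * (l + (n%:R + 1)) * zonal_const l n.+1 / (l + (n%:R + 1 + 1))).
      by field; apply/andP.
    by rewrite -zn; field; exact: n3.
  by rewrite mulr0 addr0 mul1r zonal_const0 -[LHS](zonal_const1 l0); ring.
have h := stein_r (zonal_primitive l k) (D k.+1).
move: h; rewrite (zonal_poly_deriv l0 k).1 zonal_primitiveE// -/m.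
rewrite -scalerAr !BZl mulrBr -(polyC_natr R) !mul_polyC X1 BBr.
rewrite /zonal_primitive !BBl !BZl !BZr !(BDl, BDr) !(BZl, BZr).
have o1 : B (D k.+2) (D k) = 0.
  by apply: stein_orthogonal; rewrite -addn2 -[X in _ == X]addn0 eqn_add2l.
have o2 : B (D k) (D k.+2) = 0.
  by apply: stein_orthogonal; rewrite -addn2 -[X in X == _]addn0 eqn_add2l.
rewrite o1 o2 -/g IH0 IH1.
have := zonal_constS l0 k; move: zk.
have : (k.+1%:R + 2 * l) * (D k.+2).[c] = m * c * (D k.+1).[c] - k.+1%:R * (D k).[c].
  have := congr1 (horner^~ c) (zonal_poly_rec l0 k).
  by rewrite -!(polyC_natr R) !hornerE /m.
rewrite /e; set be := _ / (_ + _).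
set z0 := zonal_const l k; set z1 := zonal_const l k.+1.
set z2 := zonal_const l k.+2.
set d0 := (D k).[c]; set d1 := (D k.+1).[c]; set d2 := (D k.+2).[c].
have k2 : k.+2%:R != 0 :> R by rewrite pnatr_eq0.
have k3 : k.+1%:R + 2 * l != 0 by rewrite gt_eqF// ltr_pwDl ?mulr_ge0 ?ltr0n.
have k4 : l + k.+2%:R != 0 by rewrite gt_eqF// ltr_wpDl ?ltr0n.
move: k1 k2 k3 k4; rewrite /m -(natr1 k.+1) -(natr1 k).
set K : R := k%:R.
move=> k1 k2 k3 k4 d_rec z_rec1 z_rec2 h.
have L : c * (2 * (K + 1 + l) * (z1 * d1)) =
    (K + 1 + 2 * l) ^+ 2 * (2 * (K + 1 + 1 + l)) /
      (2 * (K + 1 + l) * (K + 1 + 1)) * g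
    + (K + 1) / (2 * (K + 1 + l)) * ((K + 1 + be * K) * z0) * d0.
  have k5 : K + 1 + l != 0.
    by apply: contraNN k1 => /eqP ->; rewrite mulr0.
  apply/eqP; rewrite -subr_eq0; apply/eqP.
  move/eqP: h; rewrite -subr_eq0 => /eqP h; rewrite -[RHS]h.
  by field; rewrite k5 k2.
have {L} : (K + 1 + 2 * l) ^+ 2 * (2 * (K + 1 + 1 + l)) /
      (2 * (K + 1 + l) * (K + 1 + 1)) * g = z1 * ((K + 1 + 2 * l) * d2).
  have -> : (K + 1 + 2 * l) ^+ 2 * (2 * (K + 1 + 1 + l)) /
      (2 * (K + 1 + l) * (K + 1 + 1)) * g =
     c * (2 * (K + 1 + l) * (z1 * d1)) -
     (K + 1) / (2 * (K + 1 + l)) * ((K + 1 + be * K) * z0) * d0.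
    by rewrite L addrK.
  rewrite d_rec z_rec1; field.
  by apply: contraNN k1 => /eqP ->; rewrite mulr0.
have k5 : K + 1 + l != 0.
  by apply: contraNN k1 => /eqP ->; rewrite mulr0.
have k7 : l + (K + 1) != 0 by rewrite addrC.
have z2E : z1 = (2 * l + (K + 1)) * (l + (K + 1 + 1)) * z2 /
    ((K + 1 + 1) * (l + (K + 1))).
  rewrite z_rec2; field.
  by rewrite k2 k7.
rewrite z2E => h2.
have k6 : (K + 1 + 2 * l) ^+ 2 * (2 * (K + 1 + 1 + l)) /
      (2 * (K + 1 + l) * (K + 1 + 1)) != 0.
  by rewrite !mulf_neq0 ?invr_neq0 ?mulf_neq0 ?expf_neq0 ?pnatr_eq0// addrC.
apply: (mulfI k6); rewrite h2; field.
by rewrite k2 k5.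
Qed.

End stein_form.

(** * Markov chains *)

Section integral_mixture.
Local Open Scope ereal_scope.
Context d1 d2 d3 (S1 : measurableType d1) (S2 : measurableType d2)
  (T : measurableType d3) (R : realType).
Context (m1 : {measure set S1 -> \bar R}) (D1 : set S1) (g : S1 -> T).
Context (m2 : {measure set S2 -> \bar R}) (D2 : set S2).
Context (k : S2 -> {measure set T -> \bar R}).
Hypothesis mD1 : measurable D1.
Hypothesis mg : measurable_fun setT g.
Hypothesis mD2 : measurable D2.
Hypothesis mk : forall A, measurable A -> measurable_fun [set: S2] (k ^~ A).
Hypothesis mixture : forall A, measurable A ->
  m1 (D1 `&` g @^-1` A) = \int[m2]_(x in D2) k x A.

Import HBNNSimple.

Let measurable_preimage A : measurable A -> measurable (g @^-1` A).
Proof. by move=> mA; rewrite -[X in measurable X]setTI; exact: mg. Qed.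

Let integral_mixture_nnsfun (f : {nnsfun T >-> R}) :
  \int[m1]_(x in D1) (f (g x))%:E = \int[m2]_(x in D2) \int[k x]_y (f y)%:E.
Proof.
under eq_integral do rewrite fimfunE -fsumEFin//.
rewrite ge0_integral_fsum//; last 2 first.
- move=> r; apply/measurable_EFinP; apply: measurable_funTS.
  by apply: measurable_funM => //; exact: (measurableT_comp (measurable_indic _)).
- by move=> r x _; rewrite EFinM nnfun_muleindic_ge0.
under [in RHS]eq_integral.
  move=> y _.
  under eq_integral.
    by move=> z _; rewrite fimfunE -fsumEFin//; over.
  rewrite /= ge0_integral_fsum//; last 2 first.
    - by move=> r; exact/measurable_EFinP/measurableT_comp.
    - by move=> r z _; rewrite EFinM nnfun_muleindic_ge0.
  under eq_fsbigr.
    move=> r _.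
    rewrite (integralZl_indic _ (fun r => f @^-1` [set r]))//; last first.
      by move=> r0; rewrite preimage_nnfun0.
    rewrite integral_indic// setIT.
    over.
  over.
rewrite /= ge0_integral_fsum//; last 2 first.
- by move=> r; apply: measurable_funeM; apply: measurable_funTS; exact: mk.
- move=> n y _.
  have := mulemu_ge0 (fun n => f @^-1` [set n]).
  by apply; exact: preimage_nnfun0.
apply: eq_fsbigr => r _.
rewrite (integralZl_indic _ (fun r => f @^-1` [set r] \o g))//; last 2 first.
- by move=> r0; rewrite preimage_nnfun0.
- exact: measurable_preimage.
rewrite integral_indic//; last exact: measurable_preimage.
rewrite setIC mixture//.
(* A negative [r] is not a value of [f], so both sides vanish. *)
have [r0|r0] := leP 0%R r.
  by rewrite ge0_integralZl//; apply: measurable_funTS; exact: mk.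
rewrite integral0_eq ?mule0.
  by rewrite integral0_eq// => y _; rewrite preimage_nnfun0// measure0 mule0.
by move=> y _; rewrite preimage_nnfun0// measure0.
Qed.

(** Simple functions and monotone convergence. It serves twice: with [g] the next state it extends
    the Markov property from sets to functions, and with [g = id] it integrates against a kernel
    given by a series of densities. *)
Lemma integral_mixture f : (forall y, 0 <= f y) -> measurable_fun setT f ->
  \int[m1]_(x in D1) f (g x) = \int[m2]_(x in D2) \int[k x]_y f y.
Proof.
move=> f0 mf.
pose f_ := nnsfun_approx measurableT mf.
transitivity (\int[m1]_(x in D1) (lim ((f_ n (g x))%:E @[n --> \oo]))).
  apply/eq_integral => z _; apply/esym/cvg_lim => //=.
  exact: cvg_nnsfun_approx.
rewrite monotone_convergence//; last 3 first.
- move=> n; apply/measurable_EFinP/measurable_funTS.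
  exact: measurableT_comp.
- by move=> n z _; rewrite lee_fin.
- by move=> z _ a b ab; rewrite lee_fin; exact/lefP/nd_nnsfun_approx.
under eq_fun do rewrite integral_mixture_nnsfun.
transitivity (\int[m2]_(y in D2) lim ((\int[k y]_z (f_ n z)%:E) @[n --> \oo])).
  rewrite -monotone_convergence//.
  - move=> n; apply: measurable_funTS; apply: measurable_fun_integral_kernel => //.
    + by move=> z; rewrite lee_fin.
    + exact/measurable_EFinP.
  - by move=> n y _; apply: integral_ge0 => // z _; rewrite lee_fin.
  - move=> y _ a b ab; apply: ge0_le_integral => //.
    + by move=> z _; rewrite lee_fin.
    + exact/measurable_EFinP.
    + exact/measurable_EFinP.
    + by move=> z _; rewrite lee_fin; exact/lefP/nd_nnsfun_approx.
apply: eq_integral => y _; rewrite -monotone_convergence//; last 3 first.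
- by move=> n; exact/measurable_EFinP.
- by move=> n z _; rewrite lee_fin.
- by move=> z _ a b ab; rewrite lee_fin; exact/lefP/nd_nnsfun_approx.
by apply: eq_integral => z _; apply/cvg_lim => //; exact: cvg_nnsfun_approx.
Qed.

End integral_mixture.

(** * Images of chains, finite-dimensional distributions, uniqueness of the law *)

Section markov_chains.
Context d' (T : measurableType d') (R : realType).

Lemma history_measurable d (Omega : measurableType d) (X : nat -> Omega -> T) n :
  (forall i, measurable_fun setT (X i)) ->
  history X n `<=` measurable.
Proof.
move=> mX; apply: smallest_sub; first exact: sigma_algebra_measurable.
by move=> _ [i [A [_ mA ->]]]; rewrite -[X in measurable X]setTI; exact: mX.
Qed.

Lemma history_preimage d (Omega : measurableType d) (X : nat -> Omega -> T) n i A :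
  (i <= n)%N -> measurable A -> history X n (X i @^-1` A).
Proof. by move=> le_in mA; apply: sub_sigma_algebra; exists i, A. Qed.

Lemma history_comp d (Omega : measurableType d) (X : nat -> Omega -> T)
    d'' (T' : measurableType d'') (f : T -> T') n :
  measurable_fun setT f ->
  history (fun i omega => f (X i omega)) n `<=` history X n.
Proof.
move=> mf; apply: smallest_sub; first exact: smallest_sigma_algebra.
move=> _ [i [A [le_in mA ->]]].
apply: (@history_preimage _ _ _ _ _ (f @^-1` A)) => //.
by rewrite -[X in measurable X]setTI; exact: mf.
Qed.

Lemma historyS d (Omega : measurableType d) (X : nat -> Omega -> T) n m :
  (n <= m)%N -> history X n `<=` history X m.
Proof.
move=> le_nm; apply: sub_sigma_algebra2 => _ [i [A [le_in mA ->]]].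
by exists i, A; split=> //; exact: leq_trans le_nm.
Qed.

Lemma historyI d (Omega : measurableType d) (X : nat -> Omega -> T) n A B :
  history X n A -> history X n B -> history X n (A `&` B).
Proof. by move=> hA hB; exact: (@measurableI _ (g_sigma_algebraType _)). Qed.

(** The image has a smaller history, so the Markov property of [X] covers all its events;
    compatibility of [Q] and [Q'] makes the integrand a function of [f (X n)]. *)
Lemma markov_chain_image d (Omega : measurableType d) (P : probability Omega R)
    d'' (T' : measurableType d'') (f : T -> T')
    (Q : R.-pker T ~> T) (Q' : R.-pker T' ~> T') x0 X :
  measurable_fun setT f -> measurable [set x0] -> measurable [set f x0] ->
  (forall x A, measurable A -> Q' (f x) A = Q x (f @^-1` A)) ->
  markov_chain P Q x0 X ->
  markov_chain P Q' (f x0) (fun n omega => f (X n omega)).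
Proof.
move=> mf mx0 mfx0 QQ' [mX X0 markovX].
have mfX n : measurable_fun setT (fun omega => f (X n omega)).
  exact: measurableT_comp.
split=> //.
- apply/eqP; rewrite eq_le probability_le1/=; last first.
    by rewrite -[X in measurable X]setTI; exact: mfX.
  rewrite -X0 le_measure// ?inE; last by move=> omega /= ->.
  + by rewrite -[X in measurable X]setTI; exact: mX.
  + by rewrite -[X in measurable X]setTI; exact: mfX.
- move=> n A E mA hE.
  have mfA : measurable (f @^-1` A).
    by rewrite -[X in measurable X]setTI; exact: mf.
  under eq_integral do rewrite QQ'//.
  by rewrite -markovX//; exact: history_comp hE.
Qed.

Section chain.
Context d (Omega : measurableType d) (P : probability Omega R).
Context (Q : R.-pker T ~> T) (x0 : T) (X : nat -> Omega -> T).
Hypothesis mx0 : measurable [set x0].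
Hypothesis chainX : markov_chain P Q x0 X.
Local Open Scope ereal_scope.

Let mX n : measurable_fun setT (X n). Proof. by case: chainX. Qed.

Lemma markov_chain_integral n E (f : T -> \bar R) :
  history X n E -> (forall y, 0 <= f y) -> measurable_fun setT f ->
  \int[P]_(omega in E) f (X n.+1 omega) =
  \int[P]_(omega in E) \int[Q (X n omega)]_y f y.
Proof.
move=> hE f0 mf.
have mE : measurable E := history_measurable mX hE.
apply: (integral_mixture (k := fun omega => Q (X n omega))) => //.
- by move=> A mA; exact: (measurableT_comp (measurable_kernel Q A mA)).
- by move=> A mA; case: chainX => _ _; exact.
Qed.

Lemma markov_chain_start (f : T -> \bar R) E :
  (forall y, 0 <= f y) -> measurable_fun setT f -> measurable E ->
  \int[P]_(omega in E) f (X 0 omega) = f x0 * P E.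
Proof.
move=> f0 mf mE.
have mX0 : measurable (X 0 @^-1` [set x0]).
  by rewrite -[X in measurable X]setTI; exact: mX.
have X0C : P (~` (X 0 @^-1` [set x0])) = 0.
  by rewrite probability_setC//; case: chainX => _ -> _; rewrite subee.
rewrite -integral_cst//; apply: ge0_ae_eq_integral => //.
- by apply: measurable_funTS; exact: measurableT_comp.
- by move=> omega _ /=.
- exists (~` (X 0 @^-1` [set x0])); split=> //; first exact: measurableC.
  by move=> omega /= h; apply: contra_not h => /= -> _.
Qed.

(** The probability that the [m] states following [x] lie in [A 0], ..., [A (m - 1)]; the state [x]
    itself is not tested. *)
Fixpoint cylinder_prob (A : nat -> set T) (m : nat) (x : T) : \bar R :=
  if m is m'.+1 then \int[Q x]_(y in A 0%N) cylinder_prob (A \o succn) m' y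
  else 1.

Lemma cylinder_prob_ge0 A m x : 0 <= cylinder_prob A m x.
Proof. by elim: m A x => [|m IH] A x //=; exact: integral_ge0. Qed.

Lemma measurable_cylinder_prob A m : (forall i, measurable (A i)) ->
  measurable_fun setT (cylinder_prob A m).
Proof.
elim: m A => [|m IH] A mA /=; first exact: measurable_cst.
under eq_fun do rewrite integral_mkcond.
apply: measurable_fun_integral_kernel.
- by move=> U mU; exact: measurable_kernel.
- by move=> z; rewrite patchE; case: ifP => // _; exact: cylinder_prob_ge0.
- apply: (measurable_restrictT _ (mA 0%N)).1.
  by apply: measurable_funTS; apply: IH => i; exact: mA.
Qed.

(** [A], [n] and [E] vary in the induction: the first constraint joins [E] as an event of the
    history up to [n.+1], and [markov_chain_integral] then brings the integrand back from [X n.+1]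
    to [X n]. *)
Lemma markov_chain_future A m n E : (forall i, measurable (A i)) ->
  history X n E ->
  P (E `&` [set omega | forall i, (i < m)%N -> A i (X (n.+1 + i)%N omega)]) =
  \int[P]_(omega in E) cylinder_prob A m (X n omega).
Proof.
elim: m A n E => [|m IH] A n E mA hE /=.
  rewrite integral_cst ?mul1e; last exact: (history_measurable mX hE).
  by congr (P _); apply/seteqP; split=> [omega []|omega].
transitivity (P ((E `&` X n.+1 @^-1` A 0%N) `&`
   [set omega | forall i, (i < m)%N -> A i.+1 (X (n.+2 + i)%N omega)])).
  congr (P _); apply/seteqP; split=> omega /=.
    move=> [Eo h]; split.
      by split=> //; have := h 0%N; rewrite addn0; exact.
    by move=> i im; rewrite addSnnS; exact: h.
  by move=> [[Eo A0] h]; split=> // -[_|i im]; rewrite ?addn0// -addSnnS; exact: h.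
rewrite (IH (A \o succn)); last 2 first.
- by move=> i; exact: mA.
- apply: historyI; first exact: historyS hE.
  exact: history_preimage.
have mAm := measurable_cylinder_prob m (fun i => mA i.+1).
rewrite integral_mkcondr.
transitivity (\int[P]_(omega in E) (cylinder_prob (A \o succn) m \_ (A 0%N)) (X n.+1 omega)).
  by apply: eq_integral => omega _; rewrite !patchE.
rewrite markov_chain_integral//.
- by apply: eq_integral => omega _; rewrite -integral_mkcond.
- by move=> y; rewrite patchE; case: ifP => // _; exact: cylinder_prob_ge0.
- apply: (measurable_restrictT _ (mA 0%N)).1.
  by apply: measurable_funTS.
Qed.

Lemma markov_chain_cylinder A m : (forall i, measurable (A i)) ->
  P [set omega | forall i, (i <= m)%N -> A i (X i omega)] =
  (cylinder_prob (A \o succn) m \_ (A 0%N)) x0.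
Proof.
move=> mA.
transitivity (P (X 0 @^-1` A 0%N `&`
   [set omega | forall i, (i < m)%N -> A i.+1 (X (1 + i)%N omega)])).
  congr (P _); apply/seteqP; split=> omega /=.
    by move=> h; split=> [|i im]; exact: h.
  by move=> [A0 h] [_|i im] //; exact: h.
rewrite (@markov_chain_future (A \o succn) m 0)//; last 2 first.
- by move=> i; exact: mA.
- exact: history_preimage.
rewrite -[X in \int[P]_(x in X) _]setTI integral_mkcondr.
transitivity (\int[P]_omega (cylinder_prob (A \o succn) m \_ (A 0%N)) (X 0 omega)).
  by apply: eq_integral => omega _; rewrite !patchE.
rewrite markov_chain_start// ?probability_setT ?mule1//.
- by move=> y; rewrite patchE; case: ifP => // _; exact: cylinder_prob_ge0.
- apply: (measurable_restrictT _ (mA 0%N)).1; apply: measurable_funTS.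
  by apply: measurable_cylinder_prob => i; exact: mA.
Qed.

Lemma measurable_path_of : measurable_fun setT (path_of X).
Proof.
apply: measurability => // _ [_ [n [A [mA ->]]] <-].
by rewrite setTI; rewrite -[X in measurable X]setTI; exact: mX.
Qed.

End chain.

Lemma markov_chain_law_unique d1 (Omega1 : measurableType d1)
    (P1 : probability Omega1 R) (X1 : nat -> Omega1 -> T)
    d2 (Omega2 : measurableType d2) (P2 : probability Omega2 R)
    (X2 : nat -> Omega2 -> T) (Q : R.-pker T ~> T) (x0 : T) :
  measurable [set x0] ->
  markov_chain P1 Q x0 X1 -> markov_chain P2 Q x0 X2 ->
  forall E, measurable E -> path_law P1 X1 E = path_law P2 X2 E.
Proof.
move=> mx0 X1c X2c E mE.
(* One-coordinate cylinders are not stable under intersection. Products over an initial segment of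
   coordinates are, and they generate the same sigma-algebra. *)
pose G : set (set (path_space T)) := [set E | exists m (A : nat -> set T),
  (forall i, measurable (A i)) /\ E = [set p | forall i, (i <= m)%N -> A i (p i)]].
have m1 := measurable_path_of X1c; have m2 := measurable_path_of X2c.
have mG : G `<=` measurable.
  move=> _ [m [A [mA ->]]].
  rewrite (_ : [set p | _] = \bigcap_(i in [set i | (i <= m)%N]) [set p | A i (p i)]).
    apply: bigcap_measurable => [|i _]; first by exists 0%N.
    by apply: sub_sigma_algebra; exists i, (A i).
  by apply/seteqP; split=> p h i; exact: h.
apply: (measure_unique G (fun=> setT) _ _ _ _
  (pushforward P1 (path_of X1)) (pushforward P2 (path_of X2))) => //.
- apply/seteqP; split; last first.
    by apply: smallest_sub => //; exact: sigma_algebra_measurable.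
  apply: sub_sigma_algebra2 => _ [n [A [mA ->]]].
  exists n, (fun i => if i == n then A else setT); split.
    by move=> i; case: eqP.
  apply/seteqP; split=> p /= h; last by have := h n (leqnn n); rewrite eqxx.
  by move=> i _; case: eqP => // ->.
- move=> _ _ [m1' [A1 [mA1 ->]]] [m2' [A2 [mA2 ->]]].
  exists (maxn m1' m2'), (fun i => (if (i <= m1')%N then A1 i else setT) `&`
                         (if (i <= m2')%N then A2 i else setT)); split.
    by move=> i; apply: measurableI; case: ifP.
  apply/seteqP; split=> p /=.
    by move=> [h1 h2] i _; split; case: ifP => // le_i; [exact: h1|exact: h2].
  move=> h; split=> i le_i.
    have [] := h i; first by rewrite leq_max le_i.
    by rewrite le_i.
  have [] := h i; first by rewrite leq_max le_i orbT.
  by rewrite le_i.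
- by move=> i; exists 0%N, (fun=> setT); split=> //; apply/seteqP; split.
- by rewrite bigcup_const.
- move=> _ [m [A [mA ->]]].
  transitivity ((cylinder_prob Q (A \o succn) m \_ (A 0%N)) x0).
    exact: (markov_chain_cylinder mx0 X1c).
  by apply/esym; exact: (markov_chain_cylinder mx0 X2c).
- by move=> k; rewrite [ltLHS](_ : _ = P1 setT)// probability_setT ltry.
Qed.

End markov_chains.

(** * The sphere and the latitude *)

Section householder.
Context (R : realType) (n : nat).
Implicit Types w x y z : 'cV[R]_n.

Lemma dotvZl a x y : dotv (a *: x) y = a * dotv x y.
Proof. by rewrite /dotv mulr_sumr; apply: eq_bigr => i _; rewrite mxE mulrA. Qed.

Lemma dotvBl x y z : dotv (x - y) z = dotv x z - dotv y z.
Proof. by rewrite dotvDl dotvNl. Qed.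

Lemma dotvBr x y z : dotv z (x - y) = dotv z x - dotv z y.
Proof. by rewrite dotvC dotvBl !(dotvC _ z). Qed.

Lemma dotv_eq0 x : dotv x x = 0 -> x = 0.
Proof.
move=> /eqP; rewrite psumr_eq0; last by move=> i _; rewrite -expr2 sqr_ge0.
move=> /allP x0; apply/matrixP => i j; rewrite ord1 mxE.
by have := x0 i (mem_index_enum _); rewrite /= mulf_eq0 orbb => /eqP.
Qed.

(** Reflection in the hyperplane orthogonal to [w]. For [w = 0] it is the identity, which lets
    [householder_swap] include [x = y]. *)
Lemma householder_subproof w :
  let H := 1%:M - (2 / dotv w w) *: (w *m w^T) in H^T *m H = 1%:M.
Proof.
move=> H.
have HT : H^T = H by rewrite /H linearB/= linearZ/= trmx_mul trmxK trmx1.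
have ww : (w *m w^T) *m (w *m w^T) = dotv w w *: (w *m w^T).
  rewrite mulmxA -(mulmxA w) [w^T *m w]mx11_scalar -dotvE.
  by rewrite -mulmxA mul_scalar_mx scalemxAr.
rewrite HT /H mulmxBl mul1mx mulmxBr mulmx1 -scalemxAl -scalemxAr ww !scalerA.
have -> : 2 / dotv w w * (2 / dotv w w) * dotv w w = 2 / dotv w w + 2 / dotv w w.
  have [->|w0] := eqVneq (dotv w w) 0; first by rewrite invr0; ring.
  by field.
move: (w *m w^T) => M.
by apply/matrixP => i j; rewrite !mxE; ring.
Qed.

Definition householder w : orthomatrix R n := Orthomatrix (householder_subproof w).

Lemma householderE w x :
  householder w *m x = x - (2 * dotv w x / dotv w w) *: w.
Proof.
rewrite /= mulmxBl mul1mx -scalemxAl -mulmxA [w^T *m x]mx11_scalar -dotvE.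
by rewrite mul_mx_scalar scalerA mulrAC.
Qed.

Lemma householder_fix w x : dotv w x = 0 -> householder w *m x = x.
Proof. by move=> wx; rewrite householderE wx mulr0 mul0r scale0r subr0. Qed.

Lemma householder_swap x y : dotv x x = dotv y y -> householder (x - y) *m x = y.
Proof.
move=> xy; rewrite householderE.
have [|w0] := eqVneq (dotv (x - y) (x - y)) 0.
  by move=> /dotv_eq0 /eqP; rewrite subr_eq0 => /eqP ->; rewrite subrr scaler0 subr0.
have -> : 2 * dotv (x - y) x = dotv (x - y) (x - y).
  by rewrite dotvBr !dotvBl xy (dotvC y x); ring.
by rewrite divff// scale1r subKr.
Qed.

End householder.

Section sphere_measurability.
Context (R : realType) (d : nat).
Local Notation S := (sphere R d).

Lemma dotv_sphere (x : S) : dotv x x = 1.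
Proof. exact/enorm1P/sphere_valP. Qed.

Lemma sphere_coord_continuous i : continuous (fun x : S => (x : 'cV_d.+1) i 0 : R).
Proof.
move=> x.
apply: (@continuous_comp _ _ _ (@sphere_val R d) (fun M : 'cV[R]_d.+1 => M i 0)).
  exact: (@initial_continuous _ _ (@sphere_val R d)).
exact: coord_continuous.
Qed.

Lemma open_measurable_fun_realP d' (T : measurableType d') (f : T -> R) :
  (forall U, open U -> measurable (f @^-1` U)) -> measurable_fun setT f.
Proof.
move=> fU; apply: (measurability _ (RGenOpens.measurableE R)).
by move=> _ [_ [a [b ->]] <-]; rewrite setTI; apply: fU; exact: interval_open.
Qed.

Lemma measurable_sphere_coord i :
  measurable_fun setT (fun x : S => (x : 'cV_d.+1) i 0 : R).
Proof.
apply: open_measurable_fun_realP => U oU; apply: sub_sigma_algebra.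
by move/continuousP: (@sphere_coord_continuous i); exact.
Qed.

Lemma measurable_to_sphere d' (T : measurableType d') (f : T -> S) :
  (forall U, open U -> measurable (f @^-1` U)) -> measurable_fun setT f.
Proof.
by move=> fU; apply: measurability => // _ [U oU <-]; rewrite setTI; exact: fU.
Qed.

Lemma measurable_to_latitude d' (T : measurableType d') (f : T -> latitude R) :
  (forall U, open U -> measurable (f @^-1` U)) -> measurable_fun setT f.
Proof.
by move=> fU; apply: measurability => // _ [U oU <-]; rewrite setTI; exact: fU.
Qed.

Lemma continuous_to_sphere (T : topologicalType) (f : T -> S) :
  (forall i, continuous (fun x => (f x : 'cV_d.+1) i 0 : R)) -> continuous f.
Proof.
move=> cf; apply: continuous_comp_initial => x.
apply/cvg_ballP => e e0.
have : \forall y \near x, forall i : 'I_d.+1, ball ((f x : 'cV_d.+1) i 0) e ((f y : 'cV_d.+1) i 0).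
  by apply: filter_forall => i; move/cvg_ballP: (cf i x); exact.
by apply: filterS => y h; split=> // i j; rewrite ord1; exact: h.
Qed.

Lemma linear_form_continuous (c : 'I_d.+1 -> R) :
  continuous (fun x : S => \sum_i c i * (x : 'cV_d.+1) i 0).
Proof.
apply: (@continuous_big R^o) => [p|i _ x]; first exact: cvgD cvg_fst cvg_snd.
apply: (@cvgM R S (nbhs x) _ (fun=> c i)); first exact: cvg_cst.
exact: sphere_coord_continuous.
Qed.

Lemma measurable_sphere_act (U : orthomatrix R d.+1) :
  measurable_fun setT (@sphere_act R d U).
Proof.
apply: measurable_to_sphere => V oV; apply: sub_sigma_algebra.
suff /continuousP : continuous (@sphere_act R d U) by exact.
apply: continuous_to_sphere => i.
under eq_fun do rewrite mxE.
exact: linear_form_continuous.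
Qed.

Lemma dotv_continuous (eta : S) : continuous (fun x : S => dotv eta x : R).
Proof. exact: linear_form_continuous. Qed.

Lemma measurable_dotv (eta : S) : measurable_fun setT (fun x : S => dotv eta x : R).
Proof.
apply: measurable_sum => i.
by apply: measurable_funM => //; exact: measurable_sphere_coord.
Qed.

Lemma measurable_dotv2 : measurable_fun setT (fun p : S * S => dotv p.1 p.2 : R).
Proof.
by apply: measurable_sum => i; apply: measurable_funM;
  apply: (measurableT_comp (measurable_sphere_coord i)).
Qed.

Lemma measurable_latitude_of (eta : S) : measurable_fun setT (latitude_of eta).
Proof.
apply: measurable_to_latitude => V oV; apply: sub_sigma_algebra.
suff /continuousP : continuous (latitude_of eta) by exact.
apply: continuous_comp_initial; exact: dotv_continuous.
Qed.

(** On the sphere [|x - y|^2 = 2 - 2 x^t y]. Points thus become level sets of a measurable function,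
    which makes singletons measurable. *)
Lemma dotv_eq1 (x y : S) : dotv x y = 1 -> x = y.
Proof.
move=> xy; apply: val_inj => /=; apply/eqP; rewrite -subr_eq0; apply/eqP.
apply: dotv_eq0; rewrite dotvBr !dotvBl !dotv_sphere xy dotvC xy; ring.
Qed.

Lemma measurable_sphere_set1 (x : S) : measurable [set x].
Proof.
rewrite (_ : [set x] = (fun y : S => dotv x y) @^-1` [set 1]).
  by rewrite -[X in measurable X]setTI; exact: measurable_dotv.
by apply/seteqP; split=> y /= => [->|/dotv_eq1 ->//]; rewrite dotv_sphere.
Qed.

Lemma measurable_latitude_val : measurable_fun setT (@latitude_val R).
Proof.
apply: open_measurable_fun_realP => U oU; apply: sub_sigma_algebra.
by move/continuousP: (@initial_continuous _ _ (@latitude_val R)); exact.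
Qed.

Lemma measurable_latitude_set1 (t : latitude R) : measurable [set t].
Proof.
rewrite (_ : [set t] = @latitude_val R @^-1` [set latitude_val t]).
  by rewrite -[X in measurable X]setTI; exact: measurable_latitude_val.
by apply/seteqP; split=> y /= => [->//|/val_inj].
Qed.

(** Puts isotropy in the form required by [markov_chain_image], with a preimage under [U] in place
    of an image under its transpose. *)
Lemma sphere_act_tr_image (U : orthomatrix R d.+1) (A : set S) :
  sphere_act (orth_tr U) @` A = sphere_act U @^-1` A.
Proof.
have UU x : sphere_act U (sphere_act (orth_tr U) x) = x.
  by apply: val_inj; rewrite /= mulmxA (mulmx1C (orth_valP U)) mul1mx.
have UU' x : sphere_act (orth_tr U) (sphere_act U x) = x.
  by apply: val_inj; rewrite /= mulmxA orth_valP mul1mx.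
apply/seteqP; split=> [_ [x Ax <-]|x Ax] /=; last by exists (sphere_act U x).
by rewrite UU.
Qed.

(** Equal latitude says that the normal [x - y] of the mirror is orthogonal to [eta]. *)
Lemma sphere_act_fix_swap (eta x y : S) : dotv eta x = dotv eta y ->
  exists2 U : orthomatrix R d.+1, sphere_act U eta = eta & sphere_act U x = y.
Proof.
move=> exy; exists (householder (sphere_val x - sphere_val y)); apply: val_inj => /=.
  by apply: householder_fix; rewrite dotvBl dotvC exy dotvC subrr.
by apply: householder_swap; rewrite !dotv_sphere.
Qed.

(** [d >= 1] provides a second basis vector; the reflection taking the first one to [eta] takes it
    to [e]. *)
Lemma exists_sphere_orthogonal (eta : S) : (1 <= d)%N -> exists e : S, dotv eta e = 0.
Proof.
move=> d1; pose i1 : 'I_d.+1 := inord 1.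
have delta1 (i : 'I_d.+1) : enorm (delta_mx i 0 : 'cV[R]_d.+1) == 1.
  apply/enorm1P; rewrite /dotv (bigD1 i)//= big1 ?addr0; last first.
    by move=> j ji; rewrite !mxE (negbTE ji) mul0r.
  by rewrite !mxE !eqxx mulr1.
pose U : orthomatrix R d.+1 := householder (delta_mx 0 0 - sphere_val eta).
exists (sphere_act U (Sphere (delta1 i1))).
have Ueta : U *m delta_mx 0 0 = sphere_val eta.
  by apply: householder_swap; rewrite dotv_sphere; apply/enorm1P.
transitivity (dotv (U *m delta_mx 0 0) (U *m delta_mx i1 0)); first by rewrite Ueta.
rewrite dotv_orth /dotv big1// => j _; rewrite !mxE !andbT.
case: (eqVneq j 0) => [->|]; last by rewrite mul0r.
case: eqP => [/(congr1 val)|]; last by rewrite mulr0.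
by rewrite /= inordK.
Qed.

End sphere_measurability.

(** * The transition kernel of the latitude process *)

Section latitude_kernel.
Context (R : realType) (d : nat) (eta e : sphere R d).
Hypothesis eta_e : dotv eta e = 0.
Local Notation S := (sphere R d).

Lemma meridian_subproof (t : latitude R) :
  enorm (latitude_val t *: sphere_val eta + Num.sqrt (1 - latitude_val t ^+ 2) *: sphere_val e) == 1.
Proof.
have t1 : 0 <= 1 - (t : R) ^+ 2.
  by have /andP[t1 t2] := latitude_valP t; nra.
apply/enorm1P; rewrite dotvDl !dotvZl ![dotv _ (_ + _)]dotvC.
rewrite !dotvDl !dotvZl !dotv_sphere eta_e (dotvC e) eta_e !mulr0 !mulr1 addr0 add0r.
by rewrite -!expr2 sqr_sqrtr// subrKC.
Qed.

(** A continuous section of the latitude: the half great circle from [eta] to [- eta] through [e].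
    Starting [Q] on it defines the latitude kernel at every [t] and keeps it measurable in [t]. *)
Definition meridian (t : latitude R) : S := Sphere (meridian_subproof t).

Lemma meridianK : cancel meridian (latitude_of eta).
Proof.
move=> t; apply: val_inj => /=.
by rewrite dotvC dotvDl !dotvZl dotv_sphere (dotvC e) eta_e mulr0 addr0 mulr1.
Qed.

Lemma measurable_meridian : measurable_fun setT meridian.
Proof.
apply: measurable_to_sphere => V oV; apply: sub_sigma_algebra.
suff /continuousP : continuous meridian by exact.
apply: continuous_to_sphere => i.
under eq_fun do rewrite !mxE.
have cl : continuous (@latitude_val R).
  exact: (@initial_continuous _ _ (@latitude_val R)).
move=> t; apply: (@continuous_comp _ _ _ (@latitude_val R) (fun x : R =>
  x * sphere_val eta i 0 + Num.sqrt (1 - x ^+ 2) * sphere_val e i 0)).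
  exact: cl.
apply: cvgD; apply: cvgM; try exact: cvg_cst; first exact: cvg_id.
apply: (@continuous_comp _ _ _ (fun x : R => 1 - x ^+ 2) (@Num.sqrt R)).
  by apply: cvgB; [exact: cvg_cst|exact: exprn_continuous].
exact: sqrt_continuous.
Qed.

Context (Q : R.-pker S ~> S).

Definition latitude_kernel (t : latitude R) : {measure set (latitude R) -> \bar R}.
Proof.
refine (pushforward (Q (meridian t)) (latitude_of eta)).
exact: measurable_latitude_of.
Defined.

Let measurable_latitude_kernel A : measurable A ->
  measurable_fun setT (latitude_kernel ^~ A).
Proof.
move=> mA.
apply: (measurableT_comp (measurable_kernel Q (latitude_of eta @^-1` A) _)).
  by rewrite -[X in measurable X]setTI; exact: measurable_latitude_of.
exact: measurable_meridian.
Qed.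

HB.instance Definition _ := isKernel.Build _ _ _ _ R latitude_kernel
  measurable_latitude_kernel.

Let latitude_kernel_setT t : latitude_kernel t setT = 1%E.
Proof. by rewrite /latitude_kernel/= /pushforward preimage_setT prob_kernel. Qed.

HB.instance Definition _ := Kernel_isProbability.Build _ _ _ _ R latitude_kernel
  latitude_kernel_setT.

Hypothesis isoQ : isotropic_kernel Q.

Lemma latitude_kernelE x A : measurable A ->
  latitude_kernel (latitude_of eta x) A = Q x (latitude_of eta @^-1` A).
Proof.
move=> mA.
have mlA : measurable (latitude_of eta @^-1` A).
  by rewrite -[X in measurable X]setTI; exact: measurable_latitude_of.
rewrite /latitude_kernel/= /pushforward.
set y := meridian _.
have [|U Ueta Ux] := @sphere_act_fix_swap R d eta x y.
  by have /(congr1 (@latitude_val R)) := meridianK (latitude_of eta x).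
rewrite -Ux -isoQ// sphere_act_tr_image; congr (Q x _).
apply/funext => z /=; congr A; apply: val_inj => /=.
by rewrite -{1}Ueta dotv_orth.
Qed.

Lemma latitude_kernel_markov_chain d' (Omega : measurableType d')
    (P : probability Omega R) X :
  markov_chain P Q eta X ->
  markov_chain P latitude_kernel (latitude1 R)
    (fun n omega => latitude_of eta (X n omega)).
Proof.
have -> : latitude1 R = latitude_of eta eta.
  by apply: val_inj; rewrite /= dotv_sphere.
apply: markov_chain_image; first exact: measurable_latitude_of.
- exact: measurable_sphere_set1.
- exact: measurable_latitude_set1.
- exact: latitude_kernelE.
Qed.

End latitude_kernel.

Lemma isotropic_path_law (R : realType) (d : nat)
    (Q : R.-pker (sphere R d) ~> (sphere R d)) (isoQ : isotropic_kernel Q)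
    d1 (Omega1 : measurableType d1) (P1 : probability Omega1 R) X1
    d2 (Omega2 : measurableType d2) (P2 : probability Omega2 R) X2
    (eta : sphere R d) (U : orthomatrix R d.+1) :
  markov_chain P1 Q eta X1 -> markov_chain P2 Q (sphere_act U eta) X2 ->
  forall E, measurable E ->
  pushforward (path_law P1 X1) (path_act U) E = path_law P2 X2 E.
Proof.
move=> X1c X2c E mE.
suff c : markov_chain P1 Q (sphere_act U eta) (fun n omega => sphere_act U (X1 n omega)).
  exact: (markov_chain_law_unique (measurable_sphere_set1 _) c X2c).
apply: (markov_chain_image _ _ _ _ X1c); first exact: measurable_sphere_act.
- exact: measurable_sphere_set1.
- exact: measurable_sphere_set1.
- by move=> x A mA; rewrite -isoQ// sphere_act_tr_image.
Qed.

(** * The divergence theorem on the sphere *)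

(** Closed under sums, products and polynomials, and integrable for every probability, so that
    linearity of the mean needs no further integrability argument. *)
Definition bounded_mfun (R : realType) d (T : measurableType d) (f : T -> R) : Prop :=
  measurable_fun setT f /\ exists C, forall x, `|f x| <= C.

Section bounded_mfun.
Context (R : realType) d (T : measurableType d) (mu : probability T R).
Implicit Types f g : T -> R.

Lemma bounded_mfun_cst (c : R) : bounded_mfun (fun _ : T => c).
Proof. by split; [exact: measurable_cst|exists `|c|]. Qed.

Lemma bounded_mfunD f g : bounded_mfun f -> bounded_mfun g ->
  bounded_mfun (fun x => f x + g x).
Proof.
move=> [mf [C Cf]] [mg [C' Cg]]; split; first exact: measurable_funD.
by exists (C + C') => x; rewrite (le_trans (ler_normD _ _))// lerD.
Qed.

Lemma bounded_mfunM f g : bounded_mfun f -> bounded_mfun g ->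
  bounded_mfun (fun x => f x * g x).
Proof.
move=> [mf [C Cf]] [mg [C' Cg]]; split; first exact: measurable_funM.
by exists (C * C') => x; rewrite normrM ler_pM.
Qed.

Lemma bounded_mfunZ (c : R) f : bounded_mfun f -> bounded_mfun (fun x => c * f x).
Proof. by apply: bounded_mfunM; exact: bounded_mfun_cst. Qed.

Lemma bounded_mfunB f g : bounded_mfun f -> bounded_mfun g ->
  bounded_mfun (fun x => f x - g x).
Proof.
move=> bf /(bounded_mfunZ (-1)) bg.
under eq_fun do rewrite -mulN1r; exact: bounded_mfunD.
Qed.

Lemma bounded_mfun_sum (I : Type) (r : seq I) (P : pred I) (F : I -> T -> R) :
  (forall i, bounded_mfun (F i)) -> bounded_mfun (fun x => \sum_(i <- r | P i) F i x).
Proof.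
move=> bF; elim: r => [|i r IH].
  by under eq_fun do rewrite big_nil; exact: bounded_mfun_cst.
under eq_fun do rewrite big_cons.
by case: (P i) => //; exact: bounded_mfunD.
Qed.

Lemma bounded_mfun_horner (p : {poly R}) f :
  bounded_mfun f -> bounded_mfun (fun x => p.[f x]).
Proof.
move=> bf; elim/poly_ind: p => [|p c IH].
  by under eq_fun do rewrite horner0; exact: bounded_mfun_cst.
under eq_fun do rewrite hornerMXaddC.
by apply: bounded_mfunD; [exact: bounded_mfunM|exact: bounded_mfun_cst].
Qed.

Lemma bounded_mfun_integrable f : bounded_mfun f -> mu.-integrable setT (EFin \o f).
Proof.
move=> [mf [C Cf]]; apply: measurable_bounded_integrable => //.
  by rewrite (le_lt_trans (probability_le1 _ _)) ?ltry.
by exists C; split; [exact: num_real|move=> M CM x _; exact: le_trans (Cf x) (ltW CM)].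
Qed.

Lemma mean_cst (c : R) : \int[mu]_x c = c.
Proof. by rewrite Rintegral_cst// [X in fine X](_ : _ = 1%E) ?mulr1//; exact: probability_setT. Qed.

Lemma meanD f g : bounded_mfun f -> bounded_mfun g ->
  \int[mu]_x (f x + g x) = \int[mu]_x f x + \int[mu]_x g x.
Proof. by move=> bf bg; rewrite RintegralD//; exact: bounded_mfun_integrable. Qed.

Lemma meanZ (c : R) f : bounded_mfun f -> \int[mu]_x (c * f x) = c * \int[mu]_x f x.
Proof. by move=> bf; rewrite RintegralZl//; exact: bounded_mfun_integrable. Qed.

Lemma meanB f g : bounded_mfun f -> bounded_mfun g ->
  \int[mu]_x (f x - g x) = \int[mu]_x f x - \int[mu]_x g x.
Proof. by move=> bf bg; rewrite RintegralB//; exact: bounded_mfun_integrable. Qed.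

Lemma mean_sum (I : Type) (r : seq I) (P : pred I) (F : I -> T -> R) :
  (forall i, bounded_mfun (F i)) ->
  \int[mu]_x (\sum_(i <- r | P i) F i x) = \sum_(i <- r | P i) \int[mu]_x F i x.
Proof.
move=> bF; elim: r => [|i r IH].
  by under eq_Rintegral do rewrite big_nil; rewrite mean_cst big_nil.
under eq_Rintegral do rewrite big_cons.
rewrite big_cons; case: (P i) => //; rewrite meanD ?IH//.
exact: bounded_mfun_sum.
Qed.

Lemma mean_le f (C : R) : bounded_mfun f -> (forall x, `|f x| <= C) ->
  `|\int[mu]_x f x| <= C.
Proof.
move=> bf fC; have bf' := bounded_mfun_integrable bf.
rewrite (le_trans (le_normr_Rintegral _ _))// -[leRHS](mean_cst C).
apply: le_Rintegral => //; last exact/bounded_mfun_integrable/bounded_mfun_cst.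
apply: bounded_mfun_integrable; split; first by apply: measurableT_comp => //; case: bf.
by exists C => x; rewrite normr_id.
Qed.

End bounded_mfun.

(** * Differentiation along coordinate rotations *)

Section rotations.
Context (R : realType) (d : nat) (unif : probability (sphere R d) R).
Hypothesis unif_inv : is_uniform unif.
Local Notation S := (sphere R d).
Local Notation "x `_[ k ]" := (sphere_val x k 0) (at level 2, format "x `_[ k ]").

Lemma mean_act (U : orthomatrix R d.+1) (f : S -> R) : bounded_mfun f ->
  \int[unif]_x f (sphere_act U x) = \int[unif]_x f x.
Proof.
move=> bf; rewrite /Rintegral.
have bfU : bounded_mfun (fun x => f (sphere_act U x)).
  case: bf => mf [C fC]; split; last by exists C.
  by apply: measurableT_comp => //; exact: measurable_sphere_act.
have mU := @measurable_sphere_act R d U.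
have -> : (\int[unif]_x (f x)%:E = \int[pushforward unif (sphere_act U)]_x (f x)%:E)%E.
  by apply: eq_measure_integral => A mA _; rewrite /= unif_inv.
rewrite integral_pushforward//=; last exact: bounded_mfun_integrable.
by apply/measurable_EFinP; case: bf.
Qed.

Lemma sphere_coord_le1 (x : S) k : `|x`_[k]| <= 1.
Proof.
have := dotv_sphere x; rewrite /dotv (bigD1 k)//= => e.
have : 0 <= \sum_(i < d.+1 | i != k) x`_[i] * x`_[i].
  by apply: sumr_ge0 => i _; rewrite -expr2 sqr_ge0.
by rewrite ler_norml => h; apply/andP; split; nra.
Qed.

Lemma bounded_mfun_coord k : bounded_mfun (fun x : S => x`_[k]).
Proof.
split; first exact: measurable_sphere_coord.
by exists 1 => x; exact: sphere_coord_le1.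
Qed.

Lemma bounded_mfun_dotv (eta : S) : bounded_mfun (fun x : S => dotv eta x).
Proof.
by apply: bounded_mfun_sum => i; apply/bounded_mfunZ/bounded_mfun_coord.
Qed.

Section plane.
Context (i j : 'I_d.+1) (ij : i != j).

Definition rotation_axis (tau : R) : 'cV[R]_d.+1 := delta_mx j 0 + tau *: delta_mx i 0.

(* Product of two reflections: the rotation by [2 * atan tau] in the plane of
   coordinates [j] and [i]. *)
Definition rotation (tau : R) (x : S) : S :=
  sphere_act (householder (rotation_axis tau)) (sphere_act (householder (rotation_axis 0)) x).

Lemma dotv_rotation_axis tau (x : 'cV[R]_d.+1) :
  dotv (rotation_axis tau) x = x j 0 + tau * x i 0.
Proof.
have dd k : dotv (delta_mx k 0) x = x k 0.
  rewrite /dotv (bigD1 k)//= big1 ?addr0 ?mxE ?eqxx ?mul1r// => l lk.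
  by rewrite mxE (negbTE lk) mul0r.
by rewrite /rotation_axis dotvDl dotvZl !dd.
Qed.

Lemma rotation_axisE tau k :
  rotation_axis tau k 0 = (k == j)%:R + tau * (k == i)%:R.
Proof. by rewrite !mxE !andbT. Qed.

(** With [tau] the tangent of the half angle, [sin = 2 tau / (1 + tau^2)] and
    [cos - 1 = - 2 tau^2 / (1 + tau^2)]: the rotation is rational in [tau]. *)
Lemma rotationE tau (x : S) k : (rotation tau x)`_[k] =
  x`_[k] + (k == j)%:R * (- 2 * tau * (tau * x`_[j] + x`_[i]) / (1 + tau ^+ 2))
   + (k == i)%:R * (2 * tau * (x`_[j] - tau * x`_[i]) / (1 + tau ^+ 2)).
Proof.
have ji : j == i = false by rewrite eq_sym; exact/negbTE.
have t1 : 1 + tau ^+ 2 != 0 by rewrite gt_eqF// ltr_pwDl// sqr_ge0.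
have coord w (y : 'cV[R]_d.+1) l : (householder w *m y) l 0 =
    y l 0 - 2 * dotv w y / dotv w w * w l 0.
  by rewrite householderE !mxE.
have -> : (rotation tau x)`_[k] =
  (householder (rotation_axis tau) *m (householder (rotation_axis 0) *m sphere_val x)) k 0.
  by [].
rewrite !coord !(dotv_rotation_axis, coord) !rotation_axisE !eqxx ji (negbTE ij).
case: (eqVneq k j) => [->|kj]; first by rewrite ji /=; field.
by case: (eqVneq k i) => [->|ki] /=; field.
Qed.

(* [g] is the derivative of [f] along the rotation, normalised by
   [d(angle) = 2 d(tau)]. *)
Definition rotation_derivative (f g : S -> R) : Prop :=
  [/\ bounded_mfun f, bounded_mfun g & exists C, forall tau x, 0 <= tau <= 1 ->
    `|f (rotation tau x) - f x - 2 * tau * g x| <= C * tau ^+ 2].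

Lemma rotation_derivative_cst c : rotation_derivative (fun=> c) (fun=> 0).
Proof.
split; try exact: bounded_mfun_cst.
by exists 0 => tau x _; rewrite mulr0 subr0 subrr normr0 mul0r.
Qed.

Lemma rotation_derivative_coord k : rotation_derivative (fun x => x`_[k])
  (fun x => (k == i)%:R * x`_[j] - (k == j)%:R * x`_[i]).
Proof.
split; first exact: bounded_mfun_coord.
  by apply: bounded_mfunB; apply/bounded_mfunZ/bounded_mfun_coord.
exists 8 => tau x /andP[t0 t1]; rewrite rotationE.
have t2 : 1 + tau ^+ 2 != 0 by rewrite gt_eqF// ltr_pwDl// sqr_ge0.
(* For [k = i] and [k = j] the remainder is, up to sign, exactly of this form, with [A] a
   combination of [x_i] and [x_j]; the other coordinates do not move. *)
have bound A : `|A| <= 2 -> `|2 * tau ^+ 2 * A / (1 + tau ^+ 2)| <= 8 * tau ^+ 2.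
  move=> A2; rewrite normrM normfV [`|1 + _|]ger0_norm; last first.
    by rewrite addr_ge0// sqr_ge0.
  rewrite ler_pdivrMr ?ltr_pwDl ?sqr_ge0// normrM ger0_norm; last first.
    by rewrite mulr_ge0// sqr_ge0.
  by have := sqr_ge0 tau; have := normr_ge0 A; nra.
have le2 a b : `|a| <= 1 -> `|b| <= 1 -> `|tau * a - b| <= 2.
  by rewrite !ler_norml => /andP[? ?] /andP[? ?]; apply/andP; split; nra.
have ji : j == i = false by rewrite eq_sym; exact/negbTE.
have := sphere_coord_le1 x i; have := sphere_coord_le1 x j.
set a := x`_[i]; set b := x`_[j] => b1 a1.
case: (eqVneq k j) => [->|kj] /=.
  rewrite -/b ji; have := bound _ (le2 _ _ a1 b1); congr (`|_| <= _).
  by rewrite /=; field.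
case: (eqVneq k i) => [->|ki] /=.
  have na1 : `|- a| <= 1 by rewrite normrN.
  rewrite -/a -normrN; have := bound _ (le2 _ _ b1 na1); congr (`|_| <= _).
  by rewrite /=; field.
rewrite [X in `|X|](_ : _ = 0) ?normr0 ?mulr_ge0 ?sqr_ge0//.
by rewrite /=; field.
Qed.

Lemma rotation_derivativeD f g f' g' :
  rotation_derivative f f' -> rotation_derivative g g' ->
  rotation_derivative (fun x => f x + g x) (fun x => f' x + g' x).
Proof.
move=> [bf bf' [C hC]] [bg bg' [C' hC']]; split; try exact: bounded_mfunD.
exists (C + C') => tau x t01.
have -> : f (rotation tau x) + g (rotation tau x) - (f x + g x) - 2 * tau * (f' x + g' x)
  = (f (rotation tau x) - f x - 2 * tau * f' x) + (g (rotation tau x) - g x - 2 * tau * g' x).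
  ring.
rewrite [leRHS]mulrDl (le_trans (ler_normD _ _))//.
by apply: lerD; [exact: hC|exact: hC'].
Qed.

Lemma rotation_derivativeM f g f' g' :
  rotation_derivative f f' -> rotation_derivative g g' ->
  rotation_derivative (fun x => f x * g x) (fun x => f' x * g x + f x * g' x).
Proof.
move=> [bf bf' [C hC]] [bg bg' [C' hC']]; split.
- exact: bounded_mfunM.
- by apply: bounded_mfunD; exact: bounded_mfunM.
case: bf bf' bg bg' => [_ [a fa]] [_ [a' f'a]] [_ [b gb]] [_ [b' g'b]].
exists (C * b + (a + 2 * a') * C' + 4 * (a' * b')) => tau x t01.
have /andP[t0 t1] := t01.
set y := rotation tau x.
have -> : f y * g y - f x * g x - 2 * tau * (f' x * g x + f x * g' x) =
  (f y - f x - 2 * tau * f' x) * g y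
  + (f x + 2 * tau * f' x) * (g y - g x - 2 * tau * g' x)
  + 4 * (f' x * g' x) * tau ^+ 2 by ring.
rewrite [leRHS]mulrDl [X in _ <= X + _]mulrDl (le_trans (ler_normD _ _))// lerD//.
  rewrite (le_trans (ler_normD _ _))// lerD// normrM.
    by rewrite [leRHS]mulrAC; apply: ler_pM => //; exact: hC.
  rewrite -[leRHS]mulrA; apply: ler_pM => //; last exact: hC'.
  rewrite (le_trans (ler_normD _ _))// lerD// !normrM (ger0_norm t0) ger0_norm//.
  by rewrite ler_pM// ?mulr_ge0// ler_piMr.
rewrite normrM (ger0_norm (sqr_ge0 tau)) ler_wpM2r ?sqr_ge0// normrM ger0_norm//.
by rewrite ler_wpM2l// normrM ler_pM.
Qed.

Lemma rotation_derivativeZ c f f' : rotation_derivative f f' ->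
  rotation_derivative (fun x => c * f x) (fun x => c * f' x).
Proof.
move=> h; have := rotation_derivativeM (rotation_derivative_cst c) h.
by under [X in rotation_derivative _ X]eq_fun do rewrite mul0r add0r.
Qed.

(** [f] and its rotated copy have the same mean, so integrating the remainder leaves
    [2 tau * |mean g| <= C * tau^2]. The remainder bound being uniform in [x], no limit is taken
    under the integral. *)
Lemma mean_rotation_derivative f g : rotation_derivative f g -> \int[unif]_x g x = 0.
Proof.
move=> [bf bg [C hC]]; apply/eqP; rewrite -normr_le0; apply/ler_addgt0Pl => e e0.
rewrite addr0.
have C0 : 0 <= C.
  have := hC 1 point; rewrite ler01 lexx expr1n !mulr1 => /(_ isT).
  by move=> h; apply: le_trans h; exact: normr_ge0.
(* Chosen so that [tau * C <= e]; the denominator [C + 1] allows [C = 0]. *)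
pose tau := Num.min 1 (e / (C + 1)).
have t0 : 0 < tau by rewrite lt_min ltr01/= divr_gt0// ltr_wpDl.
have t1 : tau <= 1 by rewrite ge_min lexx.
have te : tau * C <= e.
  rewrite (@le_trans _ _ (e / (C + 1) * C))// ?ler_wpM2r// ?ge_min ?lexx ?orbT//.
  by rewrite mulrAC ler_pdivrMr ?ltr_wpDl//; nra.
have bfr : bounded_mfun (fun x => f (rotation tau x)).
  case: bf => mf [M fM]; split; last by exists M.
  apply: measurableT_comp => //; apply: measurableT_comp; exact: measurable_sphere_act.
have := @mean_le _ _ _ unif (fun x => f (rotation tau x) - f x - 2 * tau * g x) (C * tau ^+ 2).
rewrite !meanB ?meanZ//; try exact: bounded_mfunB; try exact: bounded_mfunZ.
have -> : \int[unif]_x f (rotation tau x) = \int[unif]_x f x.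
  rewrite (mean_act _ (f := fun x => f (sphere_act (householder (rotation_axis tau)) x))) ?mean_act//.
  case: bf => mf [M fM]; split; last by exists M.
  by apply: measurableT_comp => //; exact: measurable_sphere_act.
rewrite subrr sub0r normrN !normrM ger0_norm// (ger0_norm (ltW t0)).
move=> h; have {h} : 2 * tau * `|\int[unif]_x g x| <= C * tau ^+ 2.
  apply: h => [|x]; last by apply: hC; rewrite t1 ltW.
  apply: bounded_mfunB; last exact: bounded_mfunZ.
  exact: bounded_mfunB.
have := normr_ge0 (\int[unif]_x g x); nra.
Qed.

Lemma rotation_derivative_dotv (eta : S) : rotation_derivative (fun x => dotv eta x)
  (fun x => eta`_[i] * x`_[j] - eta`_[j] * x`_[i]).
Proof.
have : rotation_derivative (fun x => dotv eta x)
  (fun x => \sum_k eta`_[k] * ((k == i)%:R * x`_[j] - (k == j)%:R * x`_[i])).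
  rewrite /dotv; elim: (index_enum _) => [|k s IH].
    under [X in rotation_derivative X]eq_fun do rewrite big_nil.
    under [X in rotation_derivative _ X]eq_fun do rewrite big_nil.
    exact: rotation_derivative_cst.
  under [X in rotation_derivative X]eq_fun do rewrite big_cons.
  under [X in rotation_derivative _ X]eq_fun do rewrite big_cons.
  apply: rotation_derivativeD IH.
  exact/rotation_derivativeZ/rotation_derivative_coord.
congr rotation_derivative; apply/funext => x.
under eq_bigr do rewrite mulrBr; rewrite sumrB; congr (_ - _).
  rewrite (bigD1 i)//= big1 ?addr0 ?eqxx ?mul1r// => k ki.
  by rewrite (negbTE ki) mul0r mulr0.
rewrite (bigD1 j)//= big1 ?addr0 ?eqxx ?mul1r// => k kj.
by rewrite (negbTE kj) mul0r mulr0.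
Qed.

Lemma rotation_derivative_horner (p : {poly R}) f f' : rotation_derivative f f' ->
  rotation_derivative (fun x => p.[f x]) (fun x => p^`().[f x] * f' x).
Proof.
move=> rf; elim/poly_ind: p => [|p c IH].
  under [X in rotation_derivative X]eq_fun do rewrite horner0.
  under [X in rotation_derivative _ X]eq_fun do rewrite deriv0 horner0 mul0r.
  exact: rotation_derivative_cst.
under [X in rotation_derivative X]eq_fun do rewrite hornerMXaddC.
have := rotation_derivativeD (rotation_derivativeM IH rf) (rotation_derivative_cst c).
under [X in rotation_derivative _ X]eq_fun do rewrite addr0.
under [X in _ -> rotation_derivative _ X]eq_fun => x.
  rewrite derivD derivC addr0 derivM derivX mulr1 hornerD hornerM hornerX.
  rewrite (_ : _ * _ = p^`().[f x] * f' x * f x + p.[f x] * f' x); last by ring.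
  over.
by [].
Qed.

End plane.

Lemma dotv_dotv (a b c e : 'cV[R]_d.+1) :
  \sum_i \sum_j a i 0 * b j 0 * (c i 0 * e j 0) = dotv a c * dotv b e.
Proof.
rewrite /dotv big_distrlr/=; apply: eq_bigr => i _; apply: eq_bigr => j _; ring.
Qed.

(* Divergence theorem for the tangential part of the constant field [eta]:
   sum the rotation derivatives of [x_j * p(s) * q(t)] over all planes [i, j]
   with weights [eta_i]. *)
Lemma stein_sphere (eta zeta : S) (p q : {poly R}) :
  \int[unif]_x ((1 - dotv eta x ^+ 2) * (p^`().[dotv eta x] * q.[dotv zeta x])
    + (dotv eta zeta - dotv eta x * dotv zeta x) * (p.[dotv eta x] * q^`().[dotv zeta x])
    - d%:R * (dotv eta x * (p.[dotv eta x] * q.[dotv zeta x]))) = 0.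
Proof.
pose A (x : S) := p^`().[dotv eta x] * q.[dotv zeta x].
pose B (x : S) := p.[dotv eta x] * q^`().[dotv zeta x].
pose C (x : S) := p.[dotv eta x] * q.[dotv zeta x].
(* The factor [j != i] makes [G i i] vanish although there is no rotation in that case, so the sum
   can run over all pairs. *)
pose G i j x := eta`_[i] * (x`_[j] * (A x * (eta`_[i] * x`_[j] - eta`_[j] * x`_[i])
  + B x * (zeta`_[i] * x`_[j] - zeta`_[j] * x`_[i])) - (j != i)%:R * x`_[i] * C x).
have bs := bounded_mfun_dotv eta; have bt := bounded_mfun_dotv zeta.
have bA : bounded_mfun A by apply: bounded_mfunM; exact: bounded_mfun_horner.
have bB : bounded_mfun B by apply: bounded_mfunM; exact: bounded_mfun_horner.
have bC : bounded_mfun C by apply: bounded_mfunM; exact: bounded_mfun_horner.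
have bx := bounded_mfun_coord.
have bG i j : bounded_mfun (G i j).
  apply/bounded_mfunZ/bounded_mfunB; last by apply/bounded_mfunM/bC/bounded_mfunZ.
  by apply: bounded_mfunM => //; apply: bounded_mfunD; apply: bounded_mfunM => //;
    apply: bounded_mfunB; exact: bounded_mfunZ.
have G0 i j : \int[unif]_x G i j x = 0.
  have [->|ij] := eqVneq i j.
    rewrite (_ : G j j = fun=> 0) ?mean_cst//; apply/funext => x.
    by rewrite /G eqxx /=; ring.
  have rs := rotation_derivative_dotv ij eta.
  have rt := rotation_derivative_dotv ij zeta.
  have := rotation_derivativeZ eta`_[i] (rotation_derivativeM
    (rotation_derivative_coord ij j)
    (rotation_derivativeM (rotation_derivative_horner p rs) (rotation_derivative_horner q rt))).
  move=> /mean_rotation_derivative <-; apply: eq_Rintegral => x _.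
  by rewrite /G /A /B /C eqxx (eq_sym j i) (negbTE ij) /=; ring.
transitivity (\int[unif]_x (\sum_i \sum_j G i j x)); last first.
  rewrite mean_sum ?big1// => [i _|i]; last exact: bounded_mfun_sum.
  by rewrite mean_sum ?big1.
apply: eq_Rintegral => x _; rewrite -/(A x) -/(B x) -/(C x).
(* The unit lengths of [eta] and [x] produce [1 - (eta^t x)^2] and
   [eta^t zeta - (eta^t x)(zeta^t x)]. In the last sum each [i] leaves [d] of the [d.+1] indices
   [j], which is the origin of the coefficient [d]. *)
transitivity (A x * (dotv eta eta * dotv x x - dotv eta x * dotv x eta)
  + B x * (dotv eta zeta * dotv x x - dotv eta x * dotv x zeta)
  - C x * \sum_i \sum_(j < d.+1) (j != i)%:R * (eta`_[i] * x`_[i])).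
  rewrite !dotv_sphere !(dotvC x) (_ : \sum_i _ = d%:R * dotv eta x).
    by rewrite /C; ring.
  rewrite [in RHS]/dotv mulr_sumr; apply: eq_bigr => i _; rewrite -mulr_suml.
  congr (_ * _); rewrite (bigD1 i)//= eqxx add0r (eq_bigr (fun=> 1)).
    by rewrite sumr_const cardC1 card_ord.
  by move=> j ->.
rewrite -!dotv_dotv !mulrBr !mulr_sumr -!sumrB -big_split -sumrB.
apply: eq_bigr => i _; rewrite !mulr_sumr -!sumrB -big_split -sumrB.
apply: eq_bigr => j _; rewrite /G /=; ring.
Qed.

End rotations.

(** * Zonal mixtures *)

Section zonal_kernels.
Context (R : realType) (d : nat) (hd : (1 <= d)%N).
Context (unif : probability (sphere R d) R) (unif_inv : is_uniform unif).
Local Notation S := (sphere R d).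
Let l : R := (d%:R - 1) / 2.

Lemma lambda_ge0 : 0 <= l.
Proof. by rewrite /l divr_ge0// subr_ge0 ler1n. Qed.

Lemma bounded_mfun_zonal k (x : S) : bounded_mfun (fun y : S => zonal l k (dotv x y)).
Proof.
under eq_fun do rewrite zonalE ?lambda_ge0//.
exact/bounded_mfun_horner/bounded_mfun_dotv.
Qed.

(** The reproducing property of zonal harmonics. The coefficient [d] of the divergence theorem is
    [1 + 2 * l], and the right-hand identity follows by exchanging [x] and [z]. *)
Lemma mean_zonal_zonal j k (x z : S) :
  \int[unif]_y (zonal l j (dotv x y) * zonal l k (dotv z y)) =
  if j == k then zonal_const l k * zonal l k (dotv x z) else 0.
Proof.
have l0 := lambda_ge0; rewrite zonalE//.
under eq_Rintegral do rewrite !zonalE//.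
pose B (p q : {poly R}) := \int[unif]_y (p.[dotv x y] * q.[dotv z y]).
have bp p (v : S) : bounded_mfun (fun y : S => p.[dotv v y]).
  exact/bounded_mfun_horner/bounded_mfun_dotv.
have bpq p q : bounded_mfun (fun y : S => p.[dotv x y] * q.[dotv z y]).
  exact: bounded_mfunM.
have dl : 1 + 2 * l = d%:R by rewrite /l; field.
have BZ c p q : c * B p q = \int[unif]_y (c * (p.[dotv x y] * q.[dotv z y])).
  by rewrite meanZ.
have mean_comb a b (f1 f2 f3 f4 : S -> R) : bounded_mfun f1 -> bounded_mfun f2 ->
    bounded_mfun f3 -> bounded_mfun f4 ->
    \int[unif]_y (f1 y + (a * f2 y - f3 y) - b * f4 y) =
    \int[unif]_y f1 y + (a * \int[unif]_y f2 y - \int[unif]_y f3 y)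
      - b * \int[unif]_y f4 y.
  move=> b1 b2 b3 b4.
  have b2' := bounded_mfunZ a b2; have b4' := bounded_mfunZ b b4.
  have b23 := bounded_mfunB b2' b3; have b123 := bounded_mfunD b1 b23.
  by rewrite (meanB _ b123 b4') (meanD _ b1 b23) (meanB _ b2' b3) !meanZ.
apply: (@stein_product R l (dotv x z) l0 B).
- by move=> p q r; rewrite /B -meanD//; apply: eq_Rintegral => y _; rewrite hornerD mulrDl.
- by move=> p q r; rewrite /B -meanD//; apply: eq_Rintegral => y _; rewrite hornerD mulrDr.
- by move=> a p q; rewrite BZ; apply: eq_Rintegral => y _; rewrite hornerZ mulrA.
- by move=> a p q; rewrite BZ; apply: eq_Rintegral => y _; rewrite hornerZ mulrCA.
- by rewrite /B; under eq_Rintegral do rewrite !hornerE; rewrite mean_cst.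
- move=> p q; apply/eqP; rewrite -subr_eq0 dl; apply/eqP.
  rewrite -(stein_sphere unif_inv x z p q).
  transitivity (\int[unif]_y (((1 - 'X ^+ 2) * p^`()).[dotv x y] * q.[dotv z y]
     + (dotv x z * (p.[dotv x y] * q^`().[dotv z y])
       - ('X * p).[dotv x y] * ('X * q^`()).[dotv z y])
     - d%:R * (('X * p).[dotv x y] * q.[dotv z y]))).
    by rewrite (mean_comb _ _ _ _ _ _ (bpq ((1 - 'X ^+ 2) * p^`()) q) (bpq p q^`())
      (bpq ('X * p) ('X * q^`())) (bpq ('X * p) q)).
  apply: eq_Rintegral => y _; rewrite !hornerE /=; ring.
- move=> p q; apply/eqP; rewrite -subr_eq0 dl; apply/eqP.
  rewrite -(stein_sphere unif_inv z x q p) (dotvC z x).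
  transitivity (\int[unif]_y (p.[dotv x y] * ((1 - 'X ^+ 2) * q^`()).[dotv z y]
     + (dotv x z * (p^`().[dotv x y] * q.[dotv z y])
       - ('X * p^`()).[dotv x y] * ('X * q).[dotv z y])
     - d%:R * (p.[dotv x y] * ('X * q).[dotv z y]))).
    by rewrite (mean_comb _ _ _ _ _ _ (bpq p ((1 - 'X ^+ 2) * q^`())) (bpq p^`() q)
      (bpq ('X * p^`()) ('X * q)) (bpq p ('X * q))).
  apply: eq_Rintegral => y _; rewrite !hornerE /=; ring.
Qed.

Lemma zonal0 t : zonal l 0 t = 1.
Proof. by rewrite zonalE ?lambda_ge0// hornerE. Qed.

Lemma zonal1 k : zonal l k 1 = 1.
Proof. by rewrite zonalE ?lambda_ge0// zonal_poly_at1 ?lambda_ge0. Qed.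

(** For [s = 1] and [s = -1] the mean over [y] of the square of [D_k (x^t y) + s * D_k (z^t y)] is
    [2 * g * (1 + s * D_k (x^t z))], with [g > 0]. *)
Lemma zonal_le1 k (x z : S) : `|zonal l k (dotv x z)| <= 1.
Proof.
set g := zonal_const l k.
have g0 : 0 < g by apply: zonal_const_gt0; exact: lambda_ge0.
have bz := bounded_mfun_zonal k.
have bzz (u v : S) : bounded_mfun (fun y : S => zonal l k (dotv u y) * zonal l k (dotv v y)).
  exact: (bounded_mfunM (bz u) (bz v)).
have key s : `|s| = 1 -> 0 <= 2 * g * (1 + s * zonal l k (dotv x z)).
  move=> s1.
  have -> : 2 * g * (1 + s * zonal l k (dotv x z)) =
      \int[unif]_y (zonal l k (dotv x y) + s * zonal l k (dotv z y)) ^+ 2.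
    transitivity (\int[unif]_y (zonal l k (dotv x y) * zonal l k (dotv x y)
      + (2 * s * (zonal l k (dotv x y) * zonal l k (dotv z y))
      + s ^+ 2 * (zonal l k (dotv z y) * zonal l k (dotv z y))))).
      rewrite !meanD ?meanZ ?mean_zonal_zonal ?eqxx//; do ?[apply: bzz|apply: bounded_mfunZ|apply: bounded_mfunD].
      by rewrite !dotv_sphere zonal1 -(real_normK (num_real s)) s1 -/g; ring.
    by apply: eq_Rintegral => y _; ring.
  by apply: Rintegral_ge0 => y _; exact: sqr_ge0.
have h1 := key 1 (normr1 _); have h2 := key (-1) (normrN1 _).
have g2 : 0 < 2 * g by rewrite mulr_gt0.
move: h1 h2; rewrite !pmulr_rge0// mul1r mulN1r => h1 h2.
by rewrite ler_norml; apply/andP; split; lra.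
Qed.

Lemma mean_zonal k (x : S) : k != 0%N -> \int[unif]_y zonal l k (dotv x y) = 0.
Proof.
move=> k0; have := mean_zonal_zonal k 0 x x; rewrite (negbTE k0) => <-.
by apply: eq_Rintegral => y _; rewrite zonal0 mulr1.
Qed.

End zonal_kernels.

(** * Action of the chain on a zonal mixture *)

Lemma cvg_eseries_real (R : realType) (F : nat -> R) (L : R) :
  (fun N => \sum_(0 <= k < N) F k) @ \oo --> L ->
  (\sum_(0 <= k <oo) (F k)%:E = L%:E)%E.
Proof.
move=> cF; apply: cvg_lim => //.
under eq_fun do rewrite sumEFin.
by apply/fine_cvgP; split => //; apply: nearW.
Qed.

Lemma eseries_real_cvg (R : realType) (F : nat -> R) (L : R) :
  (forall k, 0 <= F k) -> (\sum_(0 <= k <oo) (F k)%:E = L%:E)%E ->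
  (fun N => \sum_(0 <= k < N) F k) @ \oo --> L.
Proof.
move=> F0 FL.
have : (fun N => \sum_(0 <= k < N) (F k)%:E)%E @ \oo --> L%:E.
  by rewrite -FL; apply: is_cvg_nneseries => k _ _; rewrite lee_fin.
under eq_fun do rewrite sumEFin.
by move/fine_cvg.
Qed.

Section zonal_mixture.
Context (R : realType) (d : nat) (hd : (1 <= d)%N).
Context (unif : probability (sphere R d) R) (unif_inv : is_uniform unif).
Context (w : nat -> R) (w0 : forall k, 0 <= w k).
Context (w1 : (\sum_(0 <= k <oo) (w k)%:E = 1)%E).
Context (Q : R.-pker (sphere R d) ~> (sphere R d)).
Local Notation S := (sphere R d).
Local Notation lambda := ((d%:R - 1) / 2 : R).
Hypothesis QE : forall (eta : S) A, measurable A ->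
  (Q eta A = \sum_(0 <= k <oo) (w k)%:E * Delta unif lambda k eta A)%E.

(** At [k = 0] the density is 1 and not [1 + D_0 = 2], as in [Delta]. *)
Definition zonal_density k (x y : S) : R :=
  if k == 0%N then 1 else 1 + zonal lambda k (dotv x y).

Lemma zonal_density_ge0 k x y : 0 <= zonal_density k x y.
Proof.
rewrite /zonal_density; case: eqP => // _.
by have := zonal_le1 hd unif_inv k x y; rewrite ler_norml => /andP[]; lra.
Qed.

Lemma bounded_mfun_zonal_density k x : bounded_mfun (zonal_density k x).
Proof.
rewrite /zonal_density; case: eqP => _; first exact: bounded_mfun_cst.
by apply: bounded_mfunD; [exact: bounded_mfun_cst|exact: bounded_mfun_zonal].
Qed.

Lemma measurable_zonal_density2 k :
  measurable_fun setT (fun p : S * S => zonal_density k p.1 p.2).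
Proof.
rewrite /zonal_density; case: eqP => _; first exact: measurable_cst.
apply: measurable_funD; first exact: measurable_cst.
under eq_fun do rewrite zonalE ?lambda_ge0//.
have b : bounded_mfun (fun p : S * S => dotv p.1 p.2).
  split; first exact: measurable_dotv2.
  by exists 1 => p; rewrite ler_norml dotv_le1// dotv_sphere.
by case: (bounded_mfun_horner (zonal_poly lambda k) b).
Qed.

Lemma DeltaE k (x : S) A : measurable A ->
  (Delta unif lambda k x A = \int[unif]_(y in A) (zonal_density k x y)%:E)%E.
Proof.
rewrite /Delta /zonal_density => mA; case: eqP => // _.
by rewrite integral_cst// mul1e.
Qed.

Lemma Delta_ge0 k x A : measurable A -> (0 <= Delta unif lambda k x A)%E.
Proof.
by move=> mA; rewrite DeltaE//; apply: integral_ge0 => y _; rewrite lee_fin zonal_density_ge0.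
Qed.

(** The signed part of [Delta], on which the transition operator acts by its eigenvalue. *)
Definition zonal_mass k A (x : S) : R := \int[unif]_(y in A) zonal lambda k (dotv x y).

Lemma integral_affine_zonal c k (x : S) A : measurable A ->
  (\int[unif]_(y in A) (1 + c * zonal lambda k (dotv x y))%:E =
   (fine (unif A) + c * zonal_mass k A x)%:E)%E.
Proof.
move=> mA.
have iA (f : S -> R) : bounded_mfun f -> unif.-integrable A (EFin \o f).
  by move=> bf; apply: integrableS (bounded_mfun_integrable _ bf).
have bz := bounded_mfun_zonal hd k x.
have b1 : bounded_mfun (fun y : S => 1 + c * zonal lambda k (dotv x y)).
  by apply: bounded_mfunD; [exact: bounded_mfun_cst|exact: bounded_mfunZ].
have fin := integrable_fin_num mA (iA _ b1).
rewrite -[LHS](fineK fin); congr EFin.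
rewrite -[LHS]/(\int[unif]_(y in A) (1 + c * zonal lambda k (dotv x y))).
rewrite RintegralD//; [|exact/iA/bounded_mfun_cst|exact/iA/bounded_mfunZ].
by rewrite RintegralZl ?Rintegral_cst ?mul1r//; exact: iA.
Qed.

Lemma Delta_real k (x : S) A : measurable A -> k != 0%N ->
  (Delta unif lambda k x A = (fine (unif A) + zonal_mass k A x)%:E)%E.
Proof.
move=> mA k0; rewrite /Delta (negbTE k0) -[zonal_mass _ _ _]mul1r.
by rewrite -integral_affine_zonal//; under [RHS]eq_integral do rewrite mul1r.
Qed.

Lemma EFin_mean (f : S -> R) : bounded_mfun f ->
  (\int[unif]_y (f y)%:E = (\int[unif]_y f y)%:E)%E.
Proof.
by move=> bf; rewrite fineK//; apply: integrable_fin_num => //; exact: bounded_mfun_integrable.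
Qed.

(** When the product of densities is expanded, the linear terms have mean zero and the product of
    zonal functions survives only for [j = k]. *)
Lemma mean_zonal_density j k (x z : S) : k != 0%N ->
  \int[unif]_y (zonal_density j x y * zonal_density k y z) =
  1 + (j == k)%:R * zonal_const lambda k * zonal lambda k (dotv x z).
Proof.
move=> k0; rewrite /zonal_density (negbTE k0).
have bz i v := bounded_mfun_zonal hd i (v : S).
have bc := @bounded_mfun_cst R _ S.
have [->|j0] := eqVneq j 0%N.
  rewrite eq_sym (negbTE k0) !mul0r addr0.
  transitivity (\int[unif]_y (1 + zonal lambda k (dotv z y))).
    by apply: eq_Rintegral => y _; rewrite mul1r dotvC.
  by rewrite meanD// mean_cst mean_zonal ?addr0.
transitivity (\int[unif]_y ((1 + zonal lambda j (dotv x y)) + (zonal lambda k (dotv z y)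
   + zonal lambda j (dotv x y) * zonal lambda k (dotv z y)))).
  by apply: eq_Rintegral => y _; rewrite (dotvC y z); ring.
have bjk := bounded_mfunM (bz j x) (bz k z).
rewrite (meanD _ (bounded_mfunD (bc 1) (bz j x)) (bounded_mfunD (bz k z) bjk)).
rewrite (meanD _ (bc 1) (bz j x)) (meanD _ (bz k z) bjk).
rewrite mean_cst !mean_zonal// mean_zonal_zonal//.
by case: eqVneq => _ /=; ring.
Qed.

Lemma Q_integral x (f : S -> \bar R) : (forall y, (0 <= f y)%E) -> measurable_fun setT f ->
  (\int[Q x]_y f y =
   \sum_(0 <= k <oo) (w k)%:E * \int[unif]_y ((zonal_density k x y)%:E * f y))%E.
Proof.
move=> f0 mf.
have wd0 k y : 0 <= w k * zonal_density k x y by rewrite mulr_ge0// zonal_density_ge0.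
have wE k : (0 <= (w k)%:E)%E by rewrite lee_fin.
(* A point mass at [y] weighted by the total density of [Q x] there, so that [Q x] is the mixture of
   the [K y] under [unif] and [integral_mixture] applies. *)
pose K (y : S) : {measure set S -> \bar R} :=
  mseries (fun k => mscale (NngNum (wd0 k y)) (dirac y)) 0.
have mdens k : measurable_fun setT (fun y => (zonal_density k x y)%:E).
  by apply/measurable_EFinP; case: (bounded_mfun_zonal_density k x).
have KE A y : measurable A -> (K y A =
    \sum_(0 <= k <oo) (w k)%:E * ((zonal_density k x y)%:E * (\1_A y)%:E))%E.
  move=> mA; apply: eq_eseriesr => k _; rewrite muleA -EFinM.
  by [].

have mind A : measurable A -> measurable_fun setT (fun y : S => (\1_A y : R)%:E).
  by move=> mA; apply/measurable_EFinP; exact: measurable_indic.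
rewrite (@integral_mixture _ _ _ _ _ _ R (Q x) setT id unif setT K)//; last 2 first.
- move=> A mA; rewrite [X in measurable_fun _ X](_ : _ = fun y => limn (fun N => \sum_(0 <= k < N)
    (w k)%:E * ((zonal_density k x y)%:E * (\1_A y)%:E))%E); last by apply/funext => y; rewrite KE.
  apply: (emeasurable_fun_cvg (fun N y => \sum_(0 <= k < N)
    (w k)%:E * ((zonal_density k x y)%:E * (\1_A y)%:E))%E).
    move=> N; apply: emeasurable_sum => k; apply: measurable_funeM.
    by apply: emeasurable_funM => //; exact: mind.
  move=> y _; apply: is_cvg_nneseries => k _ _.
  by rewrite !mule_ge0// lee_fin ?zonal_density_ge0.
- move=> A mA; rewrite setTI preimage_id QE//.
  under [RHS]eq_integral do rewrite KE//.
  rewrite integral_nneseries//.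
  + apply: eq_eseriesr => k _; rewrite ge0_integralZl//; last first.
    * by move=> y _; rewrite mule_ge0// lee_fin ?zonal_density_ge0.
    * by apply: emeasurable_funM => //; exact: mind.
    rewrite DeltaE// [in LHS]integral_mkcond; congr (_ * _)%E.
    by rewrite epatch_indic.
  + move=> k; apply: measurable_funeM.
    by apply: emeasurable_funM => //; exact: mind.
  + by move=> k y _; rewrite !mule_ge0// lee_fin ?zonal_density_ge0.
under eq_integral => y _.
  rewrite ge0_integral_measure_series//.
  under eq_eseriesr.
    move=> k _; rewrite ge0_integral_mscale// integral_dirac// diracT mul1e EFinM -muleA; over.
  over.
rewrite integral_nneseries//.
- apply: eq_eseriesr => k _; rewrite ge0_integralZl//.
  + exact: emeasurable_funM.
  + by move=> y _; rewrite mule_ge0// lee_fin zonal_density_ge0.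
- by move=> k; apply: measurable_funeM; exact: emeasurable_funM.
- by move=> k y _; rewrite !mule_ge0// lee_fin ?zonal_density_ge0.
Qed.

Lemma measurable_Delta_integrand k A : measurable A ->
  measurable_fun setT
    (fun p : S * S => (zonal_density k p.1 p.2 * \1_A p.2)%:E).
Proof.
move=> mA; apply/measurable_EFinP.
apply: measurable_funM; first exact: measurable_zonal_density2.
exact: (measurableT_comp (measurable_indic mA)).
Qed.

Lemma Delta_indic k (x : S) A : measurable A ->
  (Delta unif lambda k x A = \int[unif]_y (zonal_density k x y * \1_A y)%:E)%E.
Proof. by move=> mA; rewrite DeltaE// integral_mkcond epatch_indic. Qed.

Lemma measurable_Delta k A : measurable A ->
  measurable_fun setT (fun x : S => Delta unif lambda k x A).
Proof.
move=> mA.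
rewrite [X in measurable_fun _ X](_ : _ = fubini_F unif
  (fun p : S * S => (zonal_density k p.1 p.2 * \1_A p.2)%:E)); last first.
  by apply/funext => x; rewrite Delta_indic.
apply: measurable_fun_fubini_tonelli_F; first exact: measurable_Delta_integrand.
by move=> p; rewrite lee_fin mulr_ge0// zonal_density_ge0.
Qed.

Lemma integral_density_Delta j k (x : S) A : measurable A -> k != 0%N ->
  (\int[unif]_y ((zonal_density j x y)%:E * Delta unif lambda k y A) =
   (fine (unif A) + (j == k)%:R * zonal_const lambda k * zonal_mass k A x)%:E)%E.
Proof.
move=> mA k0.
have bd := bounded_mfun_zonal_density.
have d0 := zonal_density_ge0.
pose F (p : S * S) := (zonal_density j x p.1 * (zonal_density k p.1 p.2 * \1_A p.2))%:E.
have mF : measurable_fun setT F.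
  apply/measurable_EFinP/measurable_funM.
    by apply: (measurableT_comp (proj1 (bd j x))).
  by apply/measurable_EFinP; exact: measurable_Delta_integrand.
have F0 p : (0 <= F p)%E by rewrite lee_fin !mulr_ge0.
transitivity (\int[unif]_y \int[unif]_z F (y, z))%E.
  apply: eq_integral => y _; rewrite Delta_indic// -ge0_integralZl//.
  - apply/measurable_EFinP/measurable_funM; first by case: (bd k y).
    exact: measurable_indic.
  - by move=> z _; rewrite lee_fin mulr_ge0.
  - by rewrite lee_fin.
transitivity (\int[unif]_z \int[unif]_y F (y, z))%E; first exact: fubini_tonelli.
rewrite -integral_affine_zonal// [RHS]integral_mkcond epatch_indic.
apply: eq_integral => z _ /=.
rewrite -(mean_zonal_density j x z k0).
have bF : bounded_mfun (fun y => zonal_density j x y * zonal_density k y z).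
  apply: bounded_mfunM => //.
  rewrite (_ : zonal_density k ^~ z = zonal_density k z)//.
  by apply/funext => y; rewrite /zonal_density dotvC.
rewrite -EFinM mulrC -meanZ// -EFin_mean; last exact: bounded_mfunZ.
by apply: eq_integral => y _; rewrite /F/= mulrA mulrC.
Qed.

Lemma cvg_weights : (fun N => \sum_(0 <= k < N) w k) @ \oo --> (1 : R).
Proof. exact: eseries_real_cvg. Qed.

Lemma Q_Delta k (x : S) A : measurable A -> k != 0%N ->
  (\int[Q x]_y Delta unif lambda k y A =
   (fine (unif A) + zonal_const lambda k * w k * zonal_mass k A x)%:E)%E.
Proof.
move=> mA k0; rewrite Q_integral//; last 2 first.
- by move=> y; exact: Delta_ge0.
- exact: measurable_Delta.
under eq_eseriesr do rewrite integral_density_Delta// -EFinM.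
apply: cvg_eseries_real.
set u := fine _; set c := zonal_const _ _; set a := zonal_mass _ _ _.
(* Only the term of index [k] contributes to the signed part, so this is the partial sum as soon as
   [N > k]. *)
have : (fun N => u * \sum_(0 <= k < N) w k + c * w k * a) @ \oo --> u * 1 + c * w k * a.
  by apply: cvgD; [apply: cvgMr; exact: cvg_weights|exact: cvg_cst].
rewrite mulr1; apply: cvg_trans; apply: near_eq_cvg.
near=> N.
have kN : (k < N)%N by near: N; exact: nbhs_infty_gt.
rewrite mulr_sumr; under [RHS]eq_bigr do rewrite mulrDr.
rewrite big_split/=; congr (_ + _); first by apply: eq_bigr => j _; rewrite mulrC.
rewrite big_mkord (bigD1 (Ordinal kN))//= eqxx big1 ?addr0; first by rewrite mul1r; ring.
move=> j jk; rewrite (_ : (j == k :> nat) = false) ?mul0r ?mulr0//.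
by apply/negbTE; apply: contraNN jk => /eqP jk; apply/eqP/val_inj.
Unshelve. all: by end_near. Qed.

Section chain.
Context d' (Omega : measurableType d') (P : probability Omega R).
Context (eta : S) (X : nat -> Omega -> S) (chainX : markov_chain P Q eta X).

Let mX n : measurable_fun setT (X n). Proof. by case: chainX. Qed.

Let history_setT n : history X n setT.
Proof. exact: (@measurableT _ (g_sigma_algebraType _)). Qed.

Lemma integral_Delta_chain n k A : measurable A -> k != 0%N ->
  (\int[P]_omega Delta unif lambda k (X n omega) A =
   (fine (unif A) + (zonal_const lambda k * w k) ^+ n * zonal_mass k A eta)%:E)%E.
Proof.
move=> mA k0; set r := _ * w k; set u := fine _.
have mD := measurable_Delta k mA.
have D0 x : (0 <= Delta unif lambda k x A)%E by exact: Delta_ge0.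
elim: n => [|n IH].
  rewrite (markov_chain_start (measurable_sphere_set1 eta) chainX D0 mD measurableT).
  by rewrite [P _]probability_setT mule1 expr0 mul1r Delta_real.
rewrite (markov_chain_integral chainX (@history_setT n) D0 mD).
have l0 := lambda_ge0 R hd.
have r0 : 0 <= r by rewrite mulr_ge0// ltW// zonal_const_gt0.
have r1 : r <= 1.
  have w_le1 : w k <= 1.
    rewrite -lee_fin -w1 (le_trans _ (nneseries_lim_ge k.+1 _))//.
      by rewrite big_nat_recr//= leeDr// sume_ge0// => j _; rewrite lee_fin.
    by move=> j _ _; rewrite lee_fin.
  by rewrite -[leRHS]mulr1 ler_pM ?zonal_const_le1// ltW// zonal_const_gt0.
have u0 : 0 <= u by rewrite fine_ge0.
have mDX : measurable_fun setT (fun omega => Delta unif lambda k (X n omega) A).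
  exact: (measurableT_comp mD (mX n)).
(* The signed [zonal_mass] is traded for [Delta]: since [0 <= r <= 1], both summands are nonnegative
   and the integral splits. *)
transitivity (\int[P]_omega (((1 - r) * u)%:E + r%:E * Delta unif lambda k (X n omega) A))%E.
  apply: eq_integral => omega _; rewrite Q_Delta// Delta_real// -EFinM -EFinD.
  by congr EFin; rewrite -/r -/u; ring.
rewrite ge0_integralD//; last 3 first.
- by move=> omega _; rewrite lee_fin mulr_ge0// subr_ge0.
- by move=> omega _; rewrite mule_ge0// lee_fin.
- exact: measurable_funeM.
rewrite integral_cst// [X in (_ * X + _)%E](probability_setT P) mule1 ge0_integralZl//.
by rewrite IH -EFinM -EFinD exprS; congr EFin; ring.
Qed.

Lemma markov_chain_law n A : measurable A ->
  P (X n.+1 @^-1` A) = (\sum_(0 <= k <oo) (w k *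
    (fine (unif A) + (k != 0%N)%:R *
       ((zonal_const lambda k * w k) ^+ n * zonal_mass k A eta)))%:E)%E.
Proof.
move=> mA; rewrite -[X in P X]setTI.
have [_ _ /(_ n A setT mA (@history_setT n)) ->] := chainX.
under eq_integral do rewrite QE//.
have mDX k : measurable_fun setT (fun omega => Delta unif lambda k (X n omega) A).
  by apply: (measurableT_comp (measurable_Delta k mA)).
rewrite integral_nneseries//; last 2 first.
- by move=> k; exact: measurable_funeM.
- by move=> k omega _; rewrite mule_ge0 ?lee_fin ?Delta_ge0.
apply: eq_eseriesr => k _; rewrite ge0_integralZl//; last 2 first.
- by move=> omega _; exact: Delta_ge0.
- by rewrite lee_fin.
have [->|k0] := eqVneq k 0%N; last by rewrite integral_Delta_chain// mul1r EFinM.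
rewrite mul0r addr0 EFinM /Delta eqxx integral_cst// [X in (_ * (_ * X))%E](probability_setT P) mule1.
by rewrite fineK// fin_num_measure.
Qed.

End chain.

Lemma weight_le1 k : w k <= 1.
Proof.
rewrite -lee_fin -w1 (le_trans _ (nneseries_lim_ge k.+1 _))//.
  by rewrite big_nat_recr//= leeDr// sume_ge0// => j _; rewrite lee_fin.
by move=> j _ _; rewrite lee_fin.
Qed.

Lemma is_cvg_dominated_weights (f : nat -> R) : (forall k, 0 <= f k <= w k) ->
  cvgn (fun N => \sum_(0 <= k < N) f k).
Proof.
move=> fw; apply: nondecreasing_is_cvgn.
  apply/nondecreasing_seqP => N; rewrite big_nat_recr//= lerDl.
  by have /andP[] := fw N.
exists 1 => _ [N _ <-]; rewrite (@le_trans _ _ (\sum_(0 <= k < N) w k))//.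
  by apply: ler_sum => k _; have /andP[] := fw k.
rewrite -lee_fin -w1 -sumEFin; apply: nneseries_lim_ge => k _ _.
by rewrite lee_fin.
Qed.

Lemma Delta_le1 k (x : S) A : measurable A -> (Delta unif lambda k x A <= 1)%E.
Proof.
move=> mA; rewrite DeltaE//.
have bd := bounded_mfun_zonal_density k x.
have d0 y := zonal_density_ge0 k x y.
apply: (@le_trans _ _ (\int[unif]_y (zonal_density k x y)%:E)%E).
  apply: ge0_subset_integral => //; last by move=> y _; rewrite lee_fin.
  by apply/measurable_EFinP; case: bd.
rewrite EFin_mean// lee_fin /zonal_density; case: eqP => [_|/eqP k0].
  by rewrite mean_cst.
rewrite meanD ?mean_cst ?mean_zonal ?addr0//; first exact: bounded_mfun_cst.
exact: bounded_mfun_zonal.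
Qed.

(** Term by term the coefficients of [unif A] differ: for [k > 0] it is [w k] on the left and
    [step_weight] on the right. The differences add up to what the weight at index 0 restores. *)
Lemma eseries_step_weight n (x : S) A : measurable A ->
  (\sum_(0 <= k <oo) (w k * (fine (unif A) + (k != 0%N)%:R *
       ((zonal_const lambda k * w k) ^+ n * zonal_mass k A x)))%:E =
   \sum_(0 <= k <oo) (step_weight lambda w n.+1 k)%:E * Delta unif lambda k x A)%E.
Proof.
move=> mA; set u := fine _.
have uE : unif A = u%:E by rewrite fineK// fin_num_measure.
have Delta0 : (Delta unif lambda 0 x A = u%:E)%E by rewrite /Delta eqxx.
case: n => [|n].
  apply: eq_eseriesr => k _; rewrite /step_weight eqxx expr0 mul1r.
  have [->|k0] := eqVneq k 0%N; first by rewrite mul0r addr0 EFinM Delta0.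
  by rewrite Delta_real// mul1r EFinM.
have l0 := lambda_ge0 R hd.
pose r k := (zonal_const lambda k * w k) ^+ n.+1.
have r01 k : 0 <= r k <= 1.
  have g0 := zonal_const_gt0 l0 k; have g1 := zonal_const_le1 l0 k.
  have gw0 : 0 <= zonal_const lambda k * w k by rewrite mulr_ge0// ltW.
  have gw1 : zonal_const lambda k * w k <= 1.
    by rewrite -[leRHS]mulr1 ler_pM ?weight_le1// ltW.
  by rewrite exprn_ge0//= exprn_ile1.
(* The new weights at positive indices. With value 0 at index 0 they are dominated by [w], hence
   summable, and the new weight at 0 is [1 - W]. *)
pose f k := if k == 0%N then 0 else r k * w k.
have fw k : 0 <= f k <= w k.
  rewrite /f; case: eqP => _; first by rewrite lexx w0.
  by have /andP[r0 r1] := r01 k; rewrite mulr_ge0//= ler_piMl.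
pose W := limn (fun N => \sum_(0 <= k < N) f k).
have cW : (fun N => \sum_(0 <= k < N) f k) @ \oo --> W := is_cvg_dominated_weights fw.
pose F k := w k * (u + (k != 0%N)%:R * (r k * zonal_mass k A x)).
(* [F] lists the terms of the left series and [G] those of the right; as [w] sums to 1, the two
   corrections cancel in the sum. *)
pose G k := F k - u * (w k - f k) + (k == 0%N)%:R * ((1 - W) * u).
have u01 : 0 <= u <= 1.
  by rewrite fine_ge0//= -lee_fin -uE probability_le1.
have Fw k : 0 <= F k <= w k.
  (* For [k > 0] this is a convex combination, with weight [r k], of [unif A] and [Delta], which
     both lie in [[0, 1]]. *)
  suff /andP[h0 h1] : 0 <= u + (k != 0%N)%:R * (r k * zonal_mass k A x) <= 1.
    by rewrite mulr_ge0//= -[leRHS]mulr1 ler_wpM2l.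
  have [_|k0] := eqVneq k 0%N; first by rewrite mul0r addr0.
  have := Delta_ge0 k x mA; have := Delta_le1 k x mA.
  rewrite Delta_real// -/u !lee_fin mul1r.
  move: (r01 k) u01 => /andP[? ?] /andP[? ?] ? ?.
  by apply/andP; split; nra.
have cF : (fun N => \sum_(0 <= k < N) F k) @ \oo -->
    limn (fun N => \sum_(0 <= k < N) F k) := is_cvg_dominated_weights Fw.
rewrite (cvg_eseries_real cF); apply/esym.
transitivity (\sum_(0 <= k <oo) (G k)%:E)%E.
  apply: eq_eseriesr => k _; rewrite /G /F /f.
  have [->|k0] := eqVneq k 0%N.
    rewrite /step_weight /= Delta0 -EFinM; congr EFin.
    have -> : limn (fun N => \sum_(1 <= j < N) zonal_const lambda j ^+ n.+1 * w j ^+ n.+2) = W.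
      congr (limn _); apply/funext => -[|N]; first by rewrite !big_geq.
      rewrite [in RHS]big_ltn//= {1}/f eqxx add0r; apply: eq_big_nat => j /andP[j1 _].
      by rewrite /f /r gtn_eqF// exprMn [w j ^+ n.+2]exprSr mulrA.
    by ring.
  rewrite /step_weight /= (negbTE k0) Delta_real// -EFinM -/u; congr EFin.
  by rewrite /r [w k ^+ n.+2]exprSr exprMn; ring.
apply: cvg_eseries_real.
set L := limn _.
have : (fun N => \sum_(0 <= k < N) F k
    - u * (\sum_(0 <= k < N) w k - \sum_(0 <= k < N) f k) + (1 - W) * u) @ \oo -->
    L - u * (1 - W) + (1 - W) * u.
  apply: cvgD; last exact: cvg_cst.
  by apply: cvgB => //; apply: cvgMr; apply: cvgB => //; exact: cvg_weights.
rewrite (mulrC u) subrK; apply: cvg_trans; apply: near_eq_cvg.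
near=> N.
have N0 : (0 < N)%N by near: N; exact: nbhs_infty_gt.
rewrite /G big_split/= sumrB -mulr_sumr sumrB; congr (_ + _).
rewrite [in RHS]big_ltn//= mul1r big_nat_cond big1 ?addr0//.
by move=> k /andP[/andP[k1 _] _]; rewrite gtn_eqF// mul0r.
Unshelve. all: by end_near. Qed.

End zonal_mixture.

Theorem proposition14 (R : realType) (d : nat) (hd : (1 <= d)%N)
    (Q : R.-pker (sphere R d) ~> (sphere R d)) (hQ : isotropic_kernel Q)
    (disp : sphere R d -> measure_display)
    (Omega : forall eta : sphere R d, measurableType (disp eta))
    (P : forall eta : sphere R d, probability (Omega eta) R)
    (X : forall eta : sphere R d, nat -> Omega eta -> sphere R d)
    (hX : forall eta : sphere R d, markov_chain (P eta) Q eta (X eta)) :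
  let lambda : R := (d%:R - 1) / 2 in
  [/\ (* (a) *)
      forall (eta : sphere R d) (U : orthomatrix R d.+1)
        (E : set (path_space (sphere R d))), measurable E ->
        pushforward (path_law (P eta) (X eta)) (path_act U) E =
        path_law (P (sphere_act U eta)) (X (sphere_act U eta)) E,
      (* (b) *)
      forall eta : sphere R d,
        exists q : R.-pker (latitude R) ~> (latitude R),
          markov_chain (P eta) q (latitude1 R)
            (fun n omega => latitude_of eta (X eta n omega)) &
      (* (c) *)
      forall unif : probability (sphere R d) R, is_uniform unif ->
      forall w : nat -> R, (forall k, 0 <= w k) ->
        (\sum_(0 <= k <oo) (w k)%:E = 1)%E ->
        (forall (eta : sphere R d) (A : set (sphere R d)), measurable A ->
          Q eta A = \sum_(0 <= k <oo) (w k)%:E * Delta unif lambda k eta A)%E ->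
        forall (n : nat) (eta : sphere R d) (A : set (sphere R d)),
          (1 <= n)%N -> measurable A ->
          (pushforward (P eta) (X eta n) A =
           \sum_(0 <= k <oo)
             (step_weight lambda w n k)%:E * Delta unif lambda k eta A)%E].
Proof.
move=> lambda; split.
- move=> eta U E mE.
  exact: (isotropic_path_law hQ (hX eta) (hX (sphere_act U eta)) mE).
- move=> eta; have [e eta_e] := exists_sphere_orthogonal eta hd.
  exists (latitude_kernel eta_e Q).
  exact: (latitude_kernel_markov_chain eta_e hQ (hX eta)).
- move=> unif unif_inv w w0 w1 QE [//|n] eta A _ mA.
  rewrite /pushforward.
  rewrite (markov_chain_law hd unif_inv w0 w1 QE (hX eta) n mA).
  exact: (eseries_step_weight hd unif_inv w0 w1 n eta mA).
Qed.
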